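(* Let $P$ be a finite poset and let $r\ge s\ge1$ be integers. The ideal $H_{r,s}(P)$ is weakly polymatroidal. In particular, $I_{r,s}(P)$ is a Cohen–Macaulay ideal.
   Context: $P=\{p_1,\ldots,p_n\}$ is a finite poset, $K$ is a field and $S=K[x_{ij} : 1\le i\le r,\ 1\le j\le n]$. A multichain of length $r$ in $P$ is a sequence $C: p_{j_1}\le\cdots\le p_{j_r}$ of elements of $P$ (repetitions allowed). For such $C$ and $\emptyset\ne A\subseteq[r]=\{1,\ldots,r\}$ set $u_{C,A}=\prod_{i\in A}x_{ij_i}$. The ideal $I_{r,s}(P)\subset S$ is generated by all $u_{C,A}$ with $C$ a multichain of length $r$ in $P$ and $A\subseteq[r]$ with $|A|=s$. The Alexander dual $I^\vee$ of a squarefree monomial ideal $I$ is the ideal generated by the monomials $\prod_{x\in F}x$, where $F$ ranges over the sets of variables generating the minimal prime ideals of $I$. Put $H_{r,s}(P)=I_{r,s}(P)^\vee$. An ideal $I\subset S$ is called Cohen–Macaulay if $S/I$ is Cohen–Macaulay. Weakly polymatroidal: let $R=K[x_1,\ldots,x_N]$ be a polynomial ring. A monomial ideal $I\subset R$ generated in one degree, with minimal monomial generating set $G(I)$, is called weakly polymatroidal if for any two monomials $u=x_1^{a_1}\cdots x_N^{a_N}$ and $v=x_1^{b_1}\cdots x_N^{b_N}$ in $G(I)$ for which there is an integer $t$ with $a_1=b_1,\ldots,a_{t-1}=b_{t-1}$ and $a_t>b_t$, there exists $\ell>t$ such that $x_t(v/x_\ell)\in I$. This notion depends on the order of the variables of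 $R$; the statement does not name an order. *)

(* Defs.v *)
From HB Require Import structures.
From mathcomp Require Import all_boot all_order all_algebra all_fingroup.
From mathcomp Require Import generic_quotient ring_quotient.
From mathcomp Require Import ring boolp mpoly.

Set Implicit Arguments.
Unset Strict Implicit.
Unset Printing Implicit Defensive.

Import Order.TTheory GRing.Theory.

Local Open Scope ring_scope.
Local Open Scope quotient_scope.

(* Ideals given by generators are Prop-valued predicates; quantification over
   ideals uses the proper ideals [idealr] and prime ideals [prime_idealr] of
   MathComp, which are bool-valued.  Under the axioms of [boolp] every
   Prop-valued predicate is equivalent to a bool-valued one, so no ideal is
   lost. *)

Definition ideal_gen (A : comNzRingType) (G : A -> Prop) (x : A) : Prop :=
  exists (n : nat) (c g : 'I_n -> A),
    (forall i, G (g i)) /\ x = \sum_(i < n) c i * g i.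

Definition maximal_ideal (A : comNzRingType) (m : idealr A) : Prop :=
  forall J : idealr A, {subset m <= J} -> {subset J <= m}.

Definition local_ring (A : comNzRingType) (m : idealr A) : Prop :=
  maximal_ideal m /\ forall m' : idealr A, maximal_ideal m' -> m' =i m.

Section Localization.

Context (A : comNzRingType) (p : prime_idealr A).

Definition denom : Type := {s : A | s \notin p}.
HB.instance Definition _ := SubChoice.on denom.

(* The pair (a, s) stands for the fraction a / s. *)
Definition loc_pair : Type := (A * denom)%type.
HB.instance Definition _ := Choice.on loc_pair.

Definition loc_equiv : rel loc_pair := fun x y =>
  `[< exists2 t : A, t \notin p &
        t * (x.1 * val y.2 - y.1 * val x.2) = 0 >].

Lemma denom1_subproof : (1 : A) \notin p.
Proof. by rewrite idealr1. Qed.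

Lemma denomM_subproof (s t : denom) : val s * val t \notin p.
Proof. by rewrite prime_idealrM negb_or (valP s) (valP t). Qed.

Definition denom1 : denom := Sub 1 denom1_subproof.
Definition denomM (s t : denom) : denom :=
  Sub (val s * val t) (denomM_subproof s t).

Lemma loc_equiv_is_equiv : equiv_class_of loc_equiv.
Proof.
split=> [x|x y|y x z].
- by apply/asboolP; exists 1; rewrite ?denom1_subproof // subrr mulr0.
- apply/asboolP/asboolP => -[t tp e]; exists t => //;
    by rewrite -opprB mulrN e oppr0.
- move=> /asboolP[t tp e] /asboolP[u up f]; apply/asboolP.
  exists (t * u * val y.2).
    by rewrite !prime_idealrM !negb_or tp up (valP y.2).
  rewrite [LHS](_ : _ =
      u * val z.2 * (t * (x.1 * val y.2 - y.1 * val x.2))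
    + t * val x.2 * (u * (y.1 * val z.2 - z.1 * val y.2))); last by ring.
  by rewrite e f !mulr0 addr0.
Qed.

Canonical loc_equiv_equiv := EquivRelPack loc_equiv_is_equiv.
Canonical loc_equiv_encModRel := defaultEncModRel loc_equiv.

Definition localization := {eq_quot loc_equiv}.
HB.instance Definition _ : EqQuotient loc_pair loc_equiv localization :=
  EqQuotient.on localization.
HB.instance Definition _ := Choice.on localization.

Definition loc_frac (a : A) (s : denom) : localization :=
  \pi_localization (a, s).

Lemma loc_fracP (a b : A) (s t : denom) :
  loc_frac a s = loc_frac b t <->
  exists2 u : A, u \notin p & u * (a * val t - b * val s) = 0.
Proof.
split=> [/eqP|h]; first by rewrite /loc_frac piE => /asboolP.
by apply/eqP; rewrite /loc_frac piE; apply/asboolP.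
Qed.

Lemma loc_fracW (x : localization) : exists a s, x = loc_frac a s.
Proof.
by exists (repr x).1, (repr x).2; rewrite /loc_frac -surjective_pairing reprK.
Qed.

Definition loc_zero : localization := loc_frac 0 denom1.
Definition loc_one : localization := loc_frac 1 denom1.
Definition loc_opp (x : localization) : localization :=
  loc_frac (- (repr x).1) (repr x).2.
Definition loc_add (x y : localization) : localization :=
  loc_frac ((repr x).1 * val (repr y).2 + (repr y).1 * val (repr x).2)
           (denomM (repr x).2 (repr y).2).
Definition loc_mul (x y : localization) : localization :=
  loc_frac ((repr x).1 * (repr y).1) (denomM (repr x).2 (repr y).2).

Lemma loc_repr (a : A) (s : denom) :
  exists2 u : A, u \notin p &
    u * ((repr (loc_frac a s)).1 * val s - a * val (repr (loc_frac a s)).2) = 0.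
Proof. by apply/loc_fracP; rewrite /loc_frac -surjective_pairing reprK. Qed.

Lemma loc_oppE a s : loc_opp (loc_frac a s) = loc_frac (- a) s.
Proof.
have [u up e] := loc_repr a s; apply/loc_fracP; exists u => //.
by rewrite -[RHS]oppr0 -e; ring.
Qed.

Lemma loc_addE a b s t : loc_add (loc_frac a s) (loc_frac b t) =
  loc_frac (a * val t + b * val s) (denomM s t).
Proof.
have [u up e] := loc_repr a s; have [v vp f] := loc_repr b t.
apply/loc_fracP; exists (u * v); first by rewrite prime_idealrM negb_or up.
move: e f; set x := repr _; set y := repr _ => e f; rewrite !SubK.
rewrite [LHS](_ : _ =
    v * val y.2 * val t * (u * (x.1 * val s - a * val x.2))
  + u * val x.2 * val s * (v * (y.1 * val t - b * val y.2))); last by ring.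
by rewrite e f !mulr0 addr0.
Qed.

Lemma loc_mulE a b s t :
  loc_mul (loc_frac a s) (loc_frac b t) = loc_frac (a * b) (denomM s t).
Proof.
have [u up e] := loc_repr a s; have [v vp f] := loc_repr b t.
apply/loc_fracP; exists (u * v); first by rewrite prime_idealrM negb_or up.
move: e f; set x := repr _; set y := repr _ => e f; rewrite !SubK.
rewrite [LHS](_ : _ =
    v * y.1 * val t * (u * (x.1 * val s - a * val x.2))
  + u * a * val x.2 * (v * (y.1 * val t - b * val y.2))); last by ring.
by rewrite e f !mulr0 addr0.
Qed.

Lemma loc_fracI a b s t :
  a * val t = b * val s -> loc_frac a s = loc_frac b t.
Proof.
by move=> e; apply/loc_fracP; exists 1; rewrite ?denom1_subproof // e subrr mulr0.
Qed.

Lemma loc_addA : associative loc_add.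
Proof.
move=> x y z; have [a [s ->]] := loc_fracW x; have [b [t ->]] := loc_fracW y.
have [c [u ->]] := loc_fracW z; rewrite !loc_addE; apply: loc_fracI.
by rewrite !SubK; ring.
Qed.

Lemma loc_addC : commutative loc_add.
Proof.
move=> x y; have [a [s ->]] := loc_fracW x; have [b [t ->]] := loc_fracW y.
by rewrite !loc_addE; apply: loc_fracI; rewrite !SubK; ring.
Qed.

Lemma loc_add0 : left_id loc_zero loc_add.
Proof.
move=> x; have [a [s ->]] := loc_fracW x.
by rewrite loc_addE; apply: loc_fracI; rewrite !SubK; ring.
Qed.

Lemma loc_addN : left_inverse loc_zero loc_opp loc_add.
Proof.
move=> x; have [a [s ->]] := loc_fracW x.
by rewrite loc_oppE loc_addE; apply: loc_fracI; rewrite !SubK; ring.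
Qed.

HB.instance Definition _ :=
  GRing.isZmodule.Build localization loc_addA loc_addC loc_add0 loc_addN.

Lemma loc_mulA : associative loc_mul.
Proof.
move=> x y z; have [a [s ->]] := loc_fracW x; have [b [t ->]] := loc_fracW y.
have [c [u ->]] := loc_fracW z; rewrite !loc_mulE; apply: loc_fracI.
by rewrite !SubK; ring.
Qed.

Lemma loc_mulC : commutative loc_mul.
Proof.
move=> x y; have [a [s ->]] := loc_fracW x; have [b [t ->]] := loc_fracW y.
by rewrite !loc_mulE; apply: loc_fracI; rewrite !SubK; ring.
Qed.

Lemma loc_mul1 : left_id loc_one loc_mul.
Proof.
move=> x; have [a [s ->]] := loc_fracW x.
by rewrite loc_mulE; apply: loc_fracI; rewrite !SubK; ring.
Qed.

Lemma loc_mulDl : left_distributive loc_mul +%R.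
Proof.
move=> x y z; have [a [s ->]] := loc_fracW x; have [b [t ->]] := loc_fracW y.
have [c [u ->]] := loc_fracW z.
rewrite -[_ + _]/(loc_add _ _) -[RHS]/(loc_add _ _).
rewrite !(loc_mulE, loc_addE); apply: loc_fracI.
by rewrite !SubK; ring.
Qed.

Lemma loc_one_neq0 : loc_one != 0.
Proof.
apply/eqP => /loc_fracP[u up]; rewrite !SubK mul0r subr0 !mulr1 => u0.
by move: up; rewrite u0 idealr0.
Qed.

HB.instance Definition _ := GRing.Zmodule_isComNzRing.Build localization
  loc_mulA loc_mulC loc_mul1 loc_mulDl loc_one_neq0.

End Localization.

(* Only p_0, ..., p_n matter; the values of p beyond n are irrelevant. *)
Definition prime_chain (A : comNzRingType) (n : nat) : Prop :=
  exists p : nat -> prime_idealr A, forall i : nat, (i < n)%N ->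
    {subset p i <= p i.+1} /\ ~ {subset p i.+1 <= p i}.

Definition krull_dim_is (A : comNzRingType) (n : nat) : Prop :=
  prime_chain A n /\ forall k : nat, prime_chain A k -> (k <= n)%N.

Definition regular_sequence (A : comNzRingType) (xs : seq A) : Prop :=
  (forall (i : nat) (a : A), (i < size xs)%N ->
     ideal_gen (fun x => x \in take i xs) (xs`_i * a) ->
     ideal_gen (fun x => x \in take i xs) a) /\
  ~ ideal_gen (fun x => x \in xs) 1.

Definition depth_is (A : comNzRingType) (m : idealr A) (n : nat) : Prop :=
  (exists xs : seq A,
     [/\ size xs = n, {subset xs <= m} & regular_sequence xs]) /\
  forall xs : seq A,
    {subset xs <= m} -> regular_sequence xs -> (size xs <= n)%N.

(* Being Noetherian is a standing assumption of the theory rather than part of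
   the two definitions below; it is automatic for quotients of polynomial rings
   over a field and for their localizations. *)
Definition CM_local_ring (A : comNzRingType) : Prop :=
  exists (m : idealr A) (n : nat),
    [/\ local_ring m, krull_dim_is A n & depth_is m n].

Definition CM_ring (A : comNzRingType) : Prop :=
  forall m : prime_idealr A, maximal_ideal m -> CM_local_ring (localization m).

Definition CM_ideal (A : comNzRingType) (I : A -> Prop) : Prop :=
  exists2 J : idealr A, (forall f, f \in J <-> I f) & CM_ring {ideal_quot J}.

Section MonomialIdeals.

Context (K : fieldType) (N : nat).
Local Notation S := {mpoly K[N]}.
Implicit Type I : S -> Prop.

Definition monomial_ideal I : Prop :=
  exists M : 'X_{1..N} -> Prop,
    forall f, I f <-> ideal_gen (fun g => exists2 m, M m & g = 'X_[m]) f.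

(* G(I): the monomials of I that are minimal for divisibility. *)
Definition min_gens I (u : 'X_{1..N}) : Prop :=
  I 'X_[u] /\ forall w : 'X_{1..N}, I 'X_[w] -> (w <= u)%MM -> w = u.

(* The variables are ordered x_1, ..., x_N with x_k = 'X_(ord k). *)
Definition weakly_polymatroidal (ord : {perm 'I_N}) I : Prop :=
  [/\ monomial_ideal I,
      exists d : nat, forall u, min_gens I u -> mdeg u = d &
      forall u v, min_gens I u -> min_gens I v ->
      forall t : 'I_N,
        (forall k : 'I_N, (k < t)%N -> u (ord k) = v (ord k)) ->
        (v (ord t) < u (ord t))%N ->
        exists l : 'I_N, [/\ (t < l)%N, (0 < v (ord l))%N &
          I ('X_(ord t) * 'X_[(v - U_(ord l))])] ].

Definition minimal_prime I (p : prime_idealr S) : Prop :=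
  (forall f, I f -> f \in p) /\
  forall q : prime_idealr S,
    (forall f, I f -> f \in q) -> {subset q <= p} -> {subset p <= q}.

Definition alexander_dual I : S -> Prop :=
  ideal_gen (fun g => exists (F : {set 'I_N}) (p : prime_idealr S),
    [/\ minimal_prime I p,
        forall f, f \in p <->
          ideal_gen (fun h => exists2 i, i \in F & h = 'X_i) f &
        g = \prod_(i in F) 'X_i]).

End MonomialIdeals.

Section MultichainIdeals.

Context (K : fieldType) (disp : Order.disp_t) (P : finPOrderType disp).
Context (r : nat).

Definition nvars : nat := #|{: 'I_r * P}|.

Definition xvar (i : 'I_r) (a : P) : {mpoly K[nvars]} := 'X_(enum_rank (i, a)).

Definition multichain (c : 'I_r -> P) : Prop :=
  forall i j : 'I_r, (i <= j)%N -> (c i <= c j)%O.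

Definition u_mon (c : 'I_r -> P) (A : {set 'I_r}) : {mpoly K[nvars]} :=
  \prod_(i in A) xvar i (c i).

Definition multichain_ideal (s : nat) : {mpoly K[nvars]} -> Prop :=
  ideal_gen (fun f => exists (c : 'I_r -> P) (A : {set 'I_r}),
    [/\ multichain c, #|A| = s & f = u_mon c A]).

Definition dual_multichain_ideal (s : nat) : {mpoly K[nvars]} -> Prop :=
  alexander_dual (multichain_ideal s).

End MultichainIdeals.

Arguments nvars {disp} P r.
Arguments multichain_ideal K {disp} P r s f : rename.
Arguments dual_multichain_ideal K {disp} P r s f : rename.

(* Main.v *)
From HB Require Import structures.
Require Import Defs.
From mathcomp Require Import all_boot all_order all_algebra all_fingroup.
From mathcomp Require Import generic_quotient ring_quotient.
From mathcomp Require Import ring zify boolp mpoly.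
From mathcomp Require classical_sets.

Set Implicit Arguments.
Unset Strict Implicit.
Unset Printing Implicit Defensive.

Import Order.TTheory GRing.Theory.

(** Why the theorem holds.

    Think of the variables as the points of the grid of r rows and one column
    for each element of P.  A monomial lies outside I when its support carries
    no s points in increasing rows and weakly increasing columns; such supports
    are the faces of a simplicial complex.  Its facets are the sets with
    exactly s - 1 points in every column such that, for each n, the number of
    points in the first n rows of column p is monotone in p.  Every face
    extends to such a set: [independent_sub_facet] builds it from the lengths of
    the longest chains.  Hence all facets have d = (s - 1)|P| points, I is the
    intersection of the primes generated by the complements of the facets
    ([multichain_idealE]), and the dual is generated by the products over these
    complements ([dual_multichain_idealE]).

    Order the variables by a linear extension of P and then by rows.  If two
    facets U and V first differ at a point of V, this point can be moved to the
    first free row above it in its column: the counts drop by one only where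
    column p of U already has fewer points than that of V, and U and V share
    all columns below p, so monotonicity survives ([facet_exchange]).  For the
    complements this is the exchange property of weakly polymatroidal ideals.

    The exchange property also decomposes the quotient ring.  If x is the first
    variable on which the minimal covers disagree, then I : x and I + (x) are
    again intersections of primes, over the covers without x and over those
    with x.  So a sequence that is regular modulo each prime (x_j : j in F) is
    regular modulo I ([facet_ideal_regular]).

    For a maximal ideal M containing I, the Nullstellensatz gives monic g_j with
    g_j(x_j) in M.  Put y_j = x_j g_j(x_j), and let e_k be the k-th elementary
    symmetric polynomial of all the y_j.  Modulo (x_j : j in F) the y_j with j
    in F vanish and only d of them remain, so e_d becomes the product of the
    remaining ones, a nonzerodivisor; modulo e_d the quotient is filtered by
    quotients modulo single y_j, where induction on d applies.  Therefore
    e_d, ..., e_1 is a regular sequence of length d contained in M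
    ([elem_syms_regular]).

    Finally d is the dimension.  A regular sequence of length d in a local ring
    yields a chain of d + 1 primes ([regular_prime_chain]).  Conversely, elements
    picked from the successive steps of a chain of primes are algebraically
    independent modulo the smallest one ([chain_independent]), while d + 1
    polynomials are always dependent modulo (x_j : j in F), because there are
    too few monomials ([algebraic_dependence]).  So depth and dimension of the
    localization at M both equal d. *)

(** * Facets of the multichain complex *)

Section Facets.
Context (disp : Order.disp_t) (P : finPOrderType disp) (r s : nat).
Context (hs : (1 <= s)%N) (hsr : (s <= r)%N).
Local Notation T := ('I_r * P)%type.
Implicit Types (W U V : {set T}) (p q : P) (i : 'I_r) (n : nat).

(** Counting up to a natural number n, rather than to a row, makes the empty
    prefix n = 0 and the full column n = r available. *)
Definition prefix_count (Q : pred 'I_r) n : nat :=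
  \sum_(0 <= k < n) oapp Q false (insub k).

Lemma prefix_count0 Q : prefix_count Q 0 = 0%N.
Proof. by rewrite /prefix_count big_geq. Qed.

Lemma prefix_countS Q i : prefix_count Q i.+1 = (prefix_count Q i + Q i)%N.
Proof. by rewrite /prefix_count big_nat_recr //= valK. Qed.

Lemma prefix_count_all Q : prefix_count Q r = #|Q|.
Proof.
rewrite /prefix_count big_mkord -sum1_card [RHS]big_mkcond /=.
by apply: eq_bigr => i _; rewrite valK /= unfold_in; case: (Q i).
Qed.

Lemma eq_prefix_count Q Q' n : (n <= r)%N -> (forall i, (i < n)%N -> Q i = Q' i) ->
  prefix_count Q n = prefix_count Q' n.
Proof.
elim: n => [|n IH] nr h; first by rewrite !prefix_count0.
rewrite (prefix_countS Q (Ordinal nr)) (prefix_countS Q' (Ordinal nr)) /= h //.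
by rewrite IH ?(ltnW nr) // => i ni; apply: h; rewrite ltnS ltnW.
Qed.

Definition column W p : pred 'I_r := fun i => (i, p) \in W.
Definition height W n p : nat := prefix_count (column W p) n.

Definition independent W : Prop := forall (c : 'I_r -> P) (A : {set 'I_r}),
  multichain c -> #|A| = s -> exists2 i, i \in A & (i, c i) \notin W.

(** Monotone counts say that the k-th point of column q lies in a row no later
    than the k-th point of column p whenever p <= q. *)
Definition facet W : bool :=
  [forall p, height W r p == s.-1] &&
  [forall p, forall q, (p <= q)%O ==> [forall n : 'I_r.+1, height W n p <= height W n q]].

Lemma facetP W : reflect ((forall p, height W r p = s.-1) /\
  (forall p q n, (p <= q)%O -> (n <= r)%N -> (height W n p <= height W n q)%N)) (facet W).
Proof.
apply: (iffP andP) => -[h1 h2]; split.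
- by move=> p; apply/eqP; move/forallP: h1.
- move=> p q n pq nr; move/forallP/(_ p)/forallP/(_ q)/implyP/(_ pq): h2.
  by move/forallP/(_ (Ordinal (nr : (n < r.+1)%N))).
- by apply/forallP => p; apply/eqP.
apply/forallP => p; apply/forallP => q; apply/implyP => pq; apply/forallP => n.
by apply: h2 => //; rewrite -ltnS.
Qed.

(** Along a multichain the count at the current place never drops when the
    column moves up and gains one at every chosen point of W, so s chosen points
    would force more than s - 1 points into the last column. *)
Lemma facet_independent W : facet W -> independent W.
Proof.
move=> /facetP[tot mono] c A mc cA; apply: contrapT => no.
have inW i : i \in A -> (i, c i) \in W.
  by move=> iA; apply: contrapT => /negP nW; apply: no; exists i.
have main n (nr : (n < r)%N) :
    (prefix_count (mem A) n.+1 <= height W n.+1 (c (Ordinal nr)))%N.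
  elim: n nr => [|n IH] nr.
    rewrite (prefix_countS _ (Ordinal nr)) /height (prefix_countS _ (Ordinal nr)).
    rewrite !prefix_count0 /= /column; case: (boolP (_ \in A)) => // /inW.
    by move=> ->.
  rewrite (prefix_countS _ (Ordinal nr)) /height (prefix_countS _ (Ordinal nr)) /=.
  apply: leq_add; last by rewrite /column; case: (boolP (_ \in A)) => // /inW ->.
  apply: leq_trans (IH (ltnW nr)) _; apply: mono; last exact: ltnW.
  by apply: mc => /=.
have r0 : (r.-1 < r)%N by lia.
have := main _ r0; rewrite prednK; last by lia.
have -> : prefix_count (mem A) r = s.
  by rewrite prefix_count_all -cA; apply: eq_card => i; rewrite unfold_in.
by rewrite tot; lia.
Qed.

Lemma facet_card W : facet W -> #|W| = (s.-1 * #|P|)%N.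
Proof.
move=> /facetP[tot _]; rewrite -sum1_card.
rewrite (eq_bigl (fun x : T => (x.1, x.2) \in W)); last by case.
rewrite -(pair_big_dep xpredT (fun i p => (i, p) \in W) (fun _ _ => 1%N)) /=.
rewrite (exchange_big_dep xpredT) //= mulnC -sum_nat_const; apply: eq_bigr => p _.
by rewrite -(tot p) /height prefix_count_all -sum1_card.
Qed.

Section Extension.
Context (W : {set T}).

(** A chain inside W is encoded by a multichain with one element for each row,
    together with the rows in which it meets W; the other rows are padding. *)
Definition below p (c : {ffun 'I_r -> P}) : bool :=
  [forall i : 'I_r, forall j : 'I_r, (i <= j)%N ==> (c i <= c j)%O] &&
  [forall i, (c i <= p)%O].

Lemma belowP p (c : {ffun 'I_r -> P}) :
  reflect (multichain c /\ forall i, (c i <= p)%O) (below p c).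
Proof.
apply: (iffP andP) => -[h1 h2]; split.
- by move=> i j ij; move/forallP/(_ i)/forallP/(_ j)/implyP: h1; apply.
- by apply/forallP.
- by apply/forallP => i; apply/forallP => j; apply/implyP; apply: h1.
by apply/forallP.
Qed.

Definition chain_pts (c : {ffun 'I_r -> P}) : pred 'I_r := fun i => (i, c i) \in W.

Definition max_chain n p : nat := \max_(c | below p c) prefix_count (chain_pts c) n.

Lemma max_chain_attained n p :
  exists2 c, below p c & max_chain n p = prefix_count (chain_pts c) n.
Proof.
have b0 : below p [ffun=> p].
  by apply/belowP; split=> [i j _|i]; rewrite !ffunE lexx.
rewrite /max_chain (bigop.bigmax_eq_arg _ b0).
by case: arg_maxnP => // c bc _; exists c.
Qed.

Lemma max_chain_le n p q : (p <= q)%O -> (max_chain n p <= max_chain n q)%N.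
Proof.
move=> pq; apply/bigop.bigmax_leqP => c /belowP[mc cp]; apply: bigop.leq_bigmax_cond.
by apply/belowP; split=> // i; apply: le_trans pq.
Qed.

Lemma max_chain0 p : max_chain 0 p = 0%N.
Proof. by have [c _ ->] := max_chain_attained 0 p; rewrite prefix_count0. Qed.

(** A point (i, p) of W extends every chain that lives in earlier rows and in
    columns at most p; conversely one row contributes at most one point. *)
Lemma max_chain_step i p :
  (max_chain i p + ((i, p) \in W) <= max_chain i.+1 p <= (max_chain i p).+1)%N.
Proof.
apply/andP; split; last first.
  have [c bc ->] := max_chain_attained i.+1 p.
  rewrite prefix_countS -addn1; apply: leq_add; last exact: leq_b1.
  exact: bigop.leq_bigmax_cond.
have [c /belowP[mc cp] ->] := max_chain_attained i p.
have [inW|_] := boolP (_ \in W); last first.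
  rewrite addn0; apply: leq_trans (bigop.leq_bigmax_cond c _); last exact/belowP.
  by rewrite prefix_countS leq_addr.
(* From row i on the chain is allowed to sit in column p itself. *)
pose c' := [ffun j : 'I_r => if (j < i)%N then c j else p].
have bc' : below p c'.
  apply/belowP; split=> [j k jk|j]; rewrite !ffunE; last by case: ifP.
  case: ifP => ji; case: ifP => ki //; first exact: mc.
  by move: ji; rewrite (leq_ltn_trans jk ki).
apply: leq_trans (bigop.leq_bigmax_cond c' bc').
rewrite prefix_countS /chain_pts ffunE ltnn inW leq_add2r.
rewrite (@eq_prefix_count _ (fun j => (j, c' j) \in W)) //; first exact: ltnW.
by move=> j ji; rewrite ffunE ji.
Qed.

Lemma max_chain_bound p : independent W -> (max_chain r p < s)%N.
Proof.
move=> ind; have [c /belowP[mc _] ->] := max_chain_attained r p.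
rewrite prefix_count_all ltnNge; apply/negP => sc.
have [A sA cA] : exists2 A : {set 'I_r}, A \subset chain_pts c & #|A| = s.
  exists [set i in take s (enum (chain_pts c))].
    by apply/subsetP => i; rewrite inE => /mem_take; rewrite mem_enum.
  rewrite cardsE (card_uniqP _) ?take_uniq ?enum_uniq // size_take -cardE.
  by case: ltngtP sc.
have [i iA] := ind c A mc cA; apply/negP; rewrite negbK.
exact: (subsetP sA).
Qed.

(** The second term is what a column needs in its first n rows in order to
    reach s - 1 points by row r even if all later rows are taken.  The maximum of
    the two terms still grows by at most one from row to row. *)
Definition level n p : nat := maxn (max_chain n p) (n - (r - s.-1)).

Lemma level_step i p : level i p <= level i.+1 p <= (level i p).+1.
Proof. by have := max_chain_step i p; rewrite /level; lia. Qed.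

Definition facet_extension : {set T} :=
  [set x : T | level x.1.+1 x.2 == (level x.1 x.2).+1].

Lemma height_facet_extension n p : (n <= r)%N -> height facet_extension n p = level n p.
Proof.
elim: n => [|n IH] nr; first by rewrite /height prefix_count0 /level max_chain0.
rewrite /height (prefix_countS _ (Ordinal nr)) -/(height _ n p) (IH (ltnW nr)).
rewrite /column inE /=; have /= := level_step (Ordinal nr) p.
by case: eqP; lia.
Qed.

(** At a point of W the chain length grows by one.  If the other term of [level]
    is the larger one, it is positive and therefore grows by one as well; so
    every point of W is a jump of [level]. *)
Lemma independent_sub_facet : independent W ->
  W \subset facet_extension /\ facet facet_extension.
Proof.
move=> ind; split.
  apply/subsetP => -[i p] inW; rewrite inE /=.
  have := max_chain_step i p; rewrite inW /level.
  have := max_chain_bound p ind.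
  lia.
apply/facetP; split=> [p|p q n pq nr]; rewrite !height_facet_extension //.
  by have := max_chain_bound p ind; rewrite /level; lia.
by have := max_chain_le n pq; rewrite /level; lia.
Qed.

End Extension.

Section Exchange.

(** The number of strictly smaller elements is a linear extension of P.  Ties
    between incomparable elements are harmless: the exchange below uses the
    order of comparable columns only. *)
Definition var_key (x : T) : nat := (#|[set q : P | (q < x.2)%O]| * r + x.1)%N.

Lemma var_key_lt_row (i j : 'I_r) p : (i < j)%N -> (var_key (i, p) < var_key (j, p))%N.
Proof. by rewrite /var_key /= ltn_add2l. Qed.

Lemma var_key_lt_col (i j : 'I_r) p q : (p < q)%O -> (var_key (i, p) < var_key (j, q))%N.
Proof.
move=> pq; rewrite /var_key /=.
have : (#|[set z : P | (z < p)%O]| < #|[set z : P | (z < q)%O]|)%N.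
  apply: proper_card; apply/properP; split.
    by apply/subsetP => z; rewrite !inE => zp; apply: lt_trans pq.
  by exists p; rewrite !inE ?ltxx.
have := ltn_ord i; have := ltn_ord j.
set a := #|_|; set b := #|_| => jr ir ab.
have : (a.+1 * r <= b * r)%N by rewrite leq_mul2r ab orbT.
by rewrite mulSn; lia.
Qed.

(** The point t = (i, p) moves to the first row j after i that V leaves free in
    column p.  The counts of column p then drop by one in the rows from i to
    j - 1, where V has strictly more points than U ([dom]).  Columns below p are
    the same in U and V, and there the counts are at most those of U in
    column p, so the drop does not break monotonicity. *)
Lemma facet_exchange U V (t : T) : facet U -> facet V ->
  (forall x, (var_key x < var_key t)%N -> (x \in U) = (x \in V)) ->
  t \in V -> t \notin U ->
  exists l, [/\ (var_key t < var_key l)%N, l \notin V & facet (l |: V :\ t)].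
Proof.
case: t => i p /facetP[totU monoU] /facetP[totV monoV] agree tV tU.
have dom n : (i < n)%N -> (n <= r)%N ->
    (forall k : 'I_r, (i < k < n)%N -> (k, p) \in V) ->
    (height U n p < height V n p)%N.
  elim: n => // n IH iin nr run; rewrite /height.
  rewrite !(prefix_countS _ (Ordinal nr)) /= -!/(height _ _ _).
  have [E|ne] := eqVneq n i.
    have -> : Ordinal nr = i by apply: val_inj.
    rewrite /column (negPf tU) tV addn0 addn1 ltnS E /height.
    rewrite (@eq_prefix_count _ (column V p)) //; first exact: ltnW.
    by move=> k ki; apply: agree; apply: var_key_lt_row.
  have lt_in : (i < n)%N by lia.
  have inV : (Ordinal nr, p) \in V by apply: run; rewrite /= lt_in leqnn.
  have run' (k : 'I_r) : (i < k < n)%N -> (k, p) \in V.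
    by move=> /andP[ik kn]; apply: run; rewrite ik ltnW.
  rewrite {2}/column inV; have := IH lt_in (ltnW nr) run'.
  by case: (column U p _); lia.
(* A free row exists, since otherwise [dom] would hold at n = r as well,
   where both counts are s - 1. *)
have [j /andP[ij jV] jmin] : exists2 j : 'I_r, (i < j)%N && ((j, p) \notin V) &
    forall k : 'I_r, (i < k < j)%N -> (k, p) \in V.
  have ex : exists n, [exists j : 'I_r, [&& (j == n :> nat), (i < j)%N & (j, p) \notin V]].
    apply: contrapT => no.
    have := dom r (ltn_ord i) (leqnn r); rewrite totU totV ltnn.
    suff run : forall k : 'I_r, (i < k < r)%N -> (k, p) \in V by move=> /(_ run).
    move=> k /andP[ik _]; apply: contrapT => /negP kV; apply: no.
    by exists k; apply/existsP; exists k; rewrite eqxx ik.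
  case: (ex_minnP ex) => n /existsP[j /and3P[/eqP jn ij jV]] nmin.
  exists j; first by rewrite ij.
  move=> k /andP[ik kj]; apply: contrapT => /negP kV.
  suff : (j <= k)%N by rewrite leqNgt kj.
  by rewrite jn; apply: nmin; apply/existsP; exists k; rewrite eqxx ik.
exists (j, p); split=> //; first exact: var_key_lt_row.
set V' := _ |: _.
have Vq n q : (n <= r)%N -> q != p -> height V' n q = height V n q.
  move=> nr qp; apply: eq_prefix_count => // k _.
  by rewrite /column !inE !xpair_eqE (negPf qp) !andbF.
have Vp n : (n <= r)%N -> (height V' n p + (i < n <= j)%N)%N = height V n p.
  elim: n => [|n IH] nr; first by rewrite /height !prefix_count0.
  rewrite /height !(prefix_countS _ (Ordinal nr)) -!/(height _ n p) -(IH (ltnW nr)).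
  rewrite {1}/column !inE !xpair_eqE eqxx !andbT -!val_eqE /=.
  have Ei : n = i -> (Ordinal nr, p) \in V.
    by move=> E; rewrite (_ : Ordinal nr = i) //; apply: val_inj.
  have Ej : n = j -> (Ordinal nr, p) \in V = false.
    by move=> E; rewrite (_ : Ordinal nr = j) ?(negPf jV) //; apply: val_inj.
  rewrite /column; move: Ei Ej; case: (_ \in V) => Ei Ej; lia.
apply/facetP; split=> [q|q q' n qq' nr].
  have [->|qp] := eqVneq q p; last by rewrite Vq.
  by have := Vp r (leqnn r); have := ltn_ord j; rewrite totV; lia.
have [E'|q'p] := eqVneq q' p; last first.
  rewrite [leqRHS]Vq //; apply: leq_trans (monoV q q' n qq' nr).
  have [->|qp] := eqVneq q p; last by rewrite Vq.
  by rewrite -(Vp n nr) leq_addr.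
have [->|qp] := eqVneq q p; first by rewrite E'.
rewrite E' in qq' *; rewrite Vq //.
have := monoV q p n qq' nr; have := Vp n nr.
case: (boolP (i < n <= j)%N) => [/andP[lt_in nj]|_] /=; last by lia.
have : (height V n q < height V n p)%N.
  apply: leq_ltn_trans (dom n lt_in nr _); last first.
    by move=> k /andP[ik kn]; apply: jmin; rewrite ik (leq_trans kn).
  apply: leq_trans (monoU q p n qq' nr).
  rewrite /height (@eq_prefix_count (column V q) (column U q)) // => k _.
  by apply/esym/agree/var_key_lt_col; rewrite lt_neqAle qp.
by lia.
Qed.

End Exchange.
End Facets.

Local Open Scope ring_scope.
Local Open Scope quotient_scope.

(** * Ideals as propositional predicates *)

Section IdealBuild.
Context (A : comNzRingType).

Definition ideal_pred (I : A -> Prop) : Prop :=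
  [/\ I 0, forall a b, I a -> I b -> I (a + b) & forall c a, I a -> I (c * a)].

Lemma ideal_predN I a : ideal_pred I -> I a -> I (- a).
Proof. by case=> _ _ IM Ia; rewrite -mulN1r; exact: IM. Qed.

Lemma ideal_predB I a b : ideal_pred I -> I a -> I b -> I (a - b).
Proof. by move=> II Ia Ib; have [_ ID _] := II; apply: ID => //; exact: ideal_predN. Qed.

Definition prime_pred (I : A -> Prop) : Prop :=
  [/\ ideal_pred I, ~ I 1 & forall a b, I (a * b) -> I a \/ I b].

Lemma idealr_of_pred (I : A -> Prop) : ideal_pred I -> ~ I 1 ->
  exists J : idealr A, forall a, a \in J <-> I a.
Proof.
move=> [I0 ID IM] I1; pose S : {pred A} := fun a => `[< I a >].
have Scl : idealr_closed S.
  split; [exact/asboolP | by apply/negP => /asboolP |].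
  by move=> a x y /asboolP Ix /asboolP Iy; apply/asboolP; apply: ID => //; exact: IM.
pose J := HB.pack_for (idealr A) (S : A -> bool) (isIdealr.Build A S Scl).
by exists J => a; split=> [/asboolP | /asboolP].
Qed.

Lemma prime_of_pred (I : A -> Prop) : prime_pred I ->
  exists J : prime_idealr A, forall a, a \in J <-> I a.
Proof.
move=> [[I0 ID IM] I1 Ip]; pose S : {pred A} := fun a => `[< I a >].
have Scl : idealr_closed S.
  split; [exact/asboolP | by apply/negP => /asboolP |].
  by move=> a x y /asboolP Ix /asboolP Iy; apply/asboolP; apply: ID => //; exact: IM.
have Sp : prime_idealr_closed S.
  by move=> a b /asboolP/Ip[] h; apply/orP; [left|right]; apply/asboolP.
pose J := HB.pack_for (prime_idealr A) (S : A -> bool)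
  (isIdealr.Build A S Scl) (isPrimeIdealrClosed.Build A S Sp).
by exists J => a; split=> [/asboolP | /asboolP].
Qed.

Lemma idealr_ideal_pred (J : idealr A) : ideal_pred (fun a => a \in J).
Proof.
split; [exact: idealr0 | by move=> a b; apply: rpredD | by move=> c a; apply: idealMr].
Qed.

Lemma prime_idealr_prime_pred (J : prime_idealr A) : prime_pred (fun a => a \in J).
Proof.
split; [exact: idealr_ideal_pred | by rewrite idealr1 |].
by move=> a b; rewrite prime_idealrM => /orP.
Qed.

(** Otherwise m + (a) would be a larger proper ideal. *)
Lemma maximal_ideal_inv (m : idealr A) (a : A) : maximal_ideal m ->
  a \notin m -> exists b, 1 - b * a \in m.
Proof.
move=> mx am; apply: contrapT => nb.
have [_ mD mM] := idealr_ideal_pred m.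
have [||J JP] := @idealr_of_pred (fun z => exists b, z - b * a \in m).
- split; first by exists 0; rewrite mul0r subr0 idealr0.
    move=> y z [b hb] [c hc]; exists (b + c).
    by rewrite mulrDl opprD addrACA; exact: mD.
  by move=> c z [b hb]; exists (c * b); rewrite -mulrA -mulrBr; exact: mM.
- exact: nb.
case/negP: am; apply: (mx J) => [z zm|]; apply/JP.
  by exists 0; rewrite mul0r subr0.
by exists 1; rewrite mul1r subrr idealr0.
Qed.

Implicit Types J : A -> Prop.

Lemma ideal_gen_ideal (G : A -> Prop) : ideal_pred (ideal_gen G).
Proof.
split.
- by exists 0%N, (fun=> 0), (fun=> 0); split; [case | rewrite big_ord0].
- move=> a b [n [c [g [hg ->]]]] [n' [c' [g' [hg' ->]]]].
  exists (n + n')%N, (fun i => match split i with inl j => c j | inr j => c' j end),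
     (fun i => match split i with inl j => g j | inr j => g' j end); split.
    by move=> i; case: split.
  rewrite big_split_ord /=; congr (_ + _); apply: eq_bigr => i _.
    by rewrite (unsplitK (inl i)).
  by rewrite (unsplitK (inr i)).
move=> d a [n [c [g [hg ->]]]]; exists n, (fun i => d * c i), g; split=> //.
by rewrite mulr_sumr; apply: eq_bigr => i _; rewrite mulrA.
Qed.

Lemma ideal_gen_mem (G : A -> Prop) g : G g -> ideal_gen G g.
Proof.
by move=> Gg; exists 1%N, (fun=> 1), (fun=> g); split; rewrite // big_ord1 mul1r.
Qed.

Lemma ideal_gen_min (G : A -> Prop) J a : ideal_pred J -> (forall g, G g -> J g) ->
  ideal_gen G a -> J a.
Proof.
move=> [J0 JD JM] sG [n [c [g [hg ->]]]].
by apply: (big_ind J) => // i _; apply: JM; apply: sG.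
Qed.

Lemma zero_ideal : ideal_pred (fun a : A => a = 0).
Proof. by split=> [//|a b -> ->|c a ->]; rewrite ?addr0 ?mulr0. Qed.

End IdealBuild.

Arguments zero_ideal {A}.

(** * Zariski's lemma *)

Section Adjoin.
Context (R : comNzRingType) (L : fieldType) (f : {rmorphism R -> L}).

Definition adjoin (x : L) : {poly R} -> L := horner_morph (fun a => mulrC x (f a)).
HB.instance Definition _ x := GRing.RMorphism.on (adjoin x).

Lemma adjoinE x p : adjoin x p = (map_poly f p).[x].
Proof. by []. Qed.

Lemma adjoinD x p q : adjoin x (p + q) = adjoin x p + adjoin x q.
Proof. exact: rmorphD. Qed.

Lemma adjoinM x p q : adjoin x (p * q) = adjoin x p * adjoin x q.
Proof. exact: rmorphM. Qed.

Lemma adjoinC x a : adjoin x a%:P = f a.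
Proof. by rewrite adjoinE map_polyC hornerC. Qed.

Lemma adjoinX x : adjoin x 'X = x.
Proof. by rewrite adjoinE map_polyX hornerX. Qed.

Definition algebraic_over (y : L) : Prop :=
  exists2 q : {poly R}, map_poly f q != 0 & root (map_poly f q) y.

(** Goldman's condition: the image of R in L becomes a field after inverting a
    single element. *)
Definition inverse_generated : Prop :=
  exists2 e : R, f e != 0 &
    forall a, f a != 0 -> exists p, (f a)^-1 = adjoin (f e)^-1 p.

Lemma adjoinV_clear e (p : {poly R}) : f e != 0 ->
  exists k r, adjoin (f e)^-1 p * f e ^+ k = f r.
Proof.
move=> e0; elim/poly_ind: p => [|p c [k [r IH]]].
  by exists 0%N, 0; rewrite !rmorph0 mul0r.
exists k.+1, (r + c * e ^+ k.+1).
rewrite adjoinD adjoinM adjoinX adjoinC mulrDl.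
rewrite rmorphD rmorphM rmorphXn -IH.
by congr (_ + _); rewrite exprS; field.
Qed.

(** It suffices to invert the leading coefficient of an equation. *)
Lemma algebraic_integral y : algebraic_over y ->
  exists2 b, f b != 0 & integralOver (adjoin (f b)^-1) y.
Proof.
case=> q q0 qy; pose b := q`_(size (map_poly f q)).-1.
have fb : f b = lead_coef (map_poly f q) by rewrite lead_coefE coef_map.
have b0 : f b != 0 by rewrite fb lead_coef_eq0.
exists b => //; apply: (@integral_root_monic _ _ _ y ((f b)^-1 *: map_poly f q)).
- by rewrite monicE lead_coefZ -fb mulVf.
- by rewrite rootZ ?invr_eq0.
apply/integral_poly => i; rewrite coefZ coef_map.
have -> : (f b)^-1 * f q`_i = adjoin (f b)^-1 ((q`_i)%:P * 'X).
  by rewrite adjoinM adjoinX adjoinC mulrC.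
exact: integral_id.
Qed.

Lemma integral_adjoinV_mull b c y : f b != 0 -> f c != 0 ->
  integralOver (adjoin (f b)^-1) y -> integralOver (adjoin (f (c * b))^-1) y.
Proof.
move=> b0 c0 [P Pm Py].
apply: (@integral_root_monic _ _ _ y (map_poly (adjoin (f b)^-1) P)) => //.
  exact: monic_map.
apply/integral_poly => i; rewrite coef_map /=.
have -> : adjoin (f b)^-1 P`_i =
          adjoin (f (c * b))^-1 (P`_i \Po (c%:P * 'X)).
  rewrite !adjoinE map_comp_poly horner_comp [map_poly f (c%:P * _)]rmorphM.
  rewrite /= map_polyC map_polyX hornerM hornerC hornerX rmorphM /= invfM.
  by rewrite mulrA divff // mul1r.
exact: integral_id.
Qed.

Lemma integral_algebraic_over b y : f b != 0 ->
  integralOver (adjoin (f b)^-1) y -> algebraic_over y.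
Proof.
move=> b0 [P Pm Py].
have [k [q [Eq]]] : exists k (q : {poly R}),
    map_poly f q = f b ^+ k *: map_poly (adjoin (f b)^-1) P.
  move: {Pm Py} P; elim/poly_ind => [|P c [k [q IH]]].
    by exists 0%N, 0; rewrite !rmorph0 scaler0.
  have [l [r Er]] := adjoinV_clear c b0.
  exists (k + l)%N, ((b ^+ l) *: q * 'X + (b ^+ k * r)%:P).
  rewrite !rmorphD !rmorphM /= !map_polyX !map_polyC /= map_polyZ /= IH.
  rewrite scalerDr !scalerA rmorphXn -exprD addnC scalerAl; congr (_ + _).
  rewrite -mul_polyC -polyCM rmorphM rmorphXn /= -Er exprD; rewrite -!polyCM; congr (_%:P).
  ring.
have bk : f b ^+ k != 0 by rewrite expf_neq0.
exists q; rewrite Eq ?rootZ //.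
by rewrite -size_poly_eq0 size_scale // size_poly_eq0 monic_neq0 ?monic_map.
Qed.

(** The reversed polynomial has the inverse as a root. *)
Lemma algebraicV y : y != 0 -> algebraic_over y -> algebraic_over y^-1.
Proof.
move=> y0 [q q0 /rootP qy]; pose n := size (map_poly f q).
have n0 : (0 < n)%N by rewrite size_poly_gt0.
exists (\poly_(i < n) q`_(n.-1 - i)).
  apply: contraNneq q0 => /(congr1 (fun p : {poly L} => p`_0)).
  rewrite coef_map coef_poly n0 subn0 coef0 -coef_map -lead_coefE.
  by move/eqP; rewrite lead_coef_eq0.
apply/rootP.
have -> : map_poly f (\poly_(i < n) q`_(n.-1 - i)) = \poly_(i < n) f q`_(n.-1 - i).
  by apply/polyP => i; rewrite coef_map !coef_poly /=; case: ifP; rewrite ?rmorph0.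
suff -> : (\poly_(i < n) f q`_(n.-1 - i)).[y^-1] = y ^- n.-1 * (map_poly f q).[y].
  by rewrite qy mulr0.
rewrite horner_poly horner_coef -/n mulr_sumr (reindex_inj rev_ord_inj).
apply: eq_bigr => i _ /=; have lei := ltn_ord i.
rewrite coef_map /= mulrCA; congr (f _`_ _ * _); first by lia.
have -> : n.-1 = (n - i.+1 + i)%N by lia.
by rewrite exprVn exprD invfM -mulrA mulVf ?expf_neq0 // mulr1.
Qed.

(** If x were transcendental, R[x] would be a polynomial ring, in which 1 + x e
    is prime to every power of e, so its inverse could not have such a power as
    denominator. *)
Lemma inverse_generated_algebraic x :
  (exists2 e : {poly R}, adjoin x e != 0 &
    forall a, adjoin x a != 0 ->
      exists k r, (adjoin x a)^-1 * adjoin x e ^+ k = adjoin x r) ->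
  algebraic_over x.
Proof.
move=> [e e0 He]; apply: contrapT => nalg.
have inj q : adjoin x q = 0 -> map_poly f q = 0.
  move=> q0; apply/eqP; apply: contrapT => /negP nz; apply: nalg; exists q => //.
  exact/rootP.
pose a := 1 + 'X * e.
set E := map_poly f e in inj *.
have Ea : map_poly f a = 1 + 'X * E.
  by rewrite rmorphD rmorphM rmorph1 /= map_polyX.
have E0 : E != 0.
  by apply: contraNneq e0 => E0; rewrite adjoinE -/E E0 horner0.
have szXE : (1 < size ('X * E)%R)%N.
  by rewrite mulrC size_mulX // ltnS size_poly_gt0.
have sza : (1 < size (1 + 'X * E)%R)%N.
  by rewrite addrC size_polyDl // size_poly1.
have a0 : adjoin x a != 0.
  apply/eqP => /inj; rewrite Ea => h.
  by rewrite h size_poly0 in sza.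
have [k [r Er]] := He _ a0.
have /inj : adjoin x (e ^+ k - r * a) = 0.
  rewrite rmorphB rmorphM rmorphXn /= -Er; field.
  exact: a0.
rewrite rmorphB rmorphM rmorphXn /= Ea -/E => /eqP; rewrite subr_eq0 => /eqP Ek.
have cop : coprimep (1 + 'X * E) (E ^+ k).
  apply: coprimep_expr; apply/Bezout_coprimepP; exists (1 : {poly L}, - 'X : {poly L}) => /=.
  by rewrite mul1r mulNr addrK eqpxx.
have := coprimepP _ _ cop (1 + 'X * E) (dvdpp _).
rewrite Ek dvdp_mull ?dvdpp // => /(_ isT); rewrite -size_poly_eq1 => /eqP s1.
by rewrite s1 in sza.
Qed.

End Adjoin.

Section AdjoinTower.
Context (L : fieldType).

Lemma inverse_generated_adjoin (R : comNzRingType) (f : {rmorphism R -> L}) x :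
  inverse_generated (adjoin f x) -> algebraic_over f x.
Proof.
case=> e e0 He; apply: inverse_generated_algebraic; exists e => // a a0.
have [p ->] := He a a0; exact: adjoinV_clear.
Qed.

(** After inverting one element c b of R, both x and the inverse of e become
    integral, hence so does the inverse of every nonzero element of R; and an
    inverse that is integral over a ring already lies in it. *)
Lemma inverse_generated_descent (R : comNzRingType) (f : {rmorphism R -> L}) x :
  inverse_generated (adjoin f x) -> inverse_generated f.
Proof.
move=> G; have [b b0 intx] := algebraic_integral (inverse_generated_adjoin G).
case: G => e e0 He.
have intC (d : R) (p : {poly R}) : integralOver (adjoin f (f d)^-1) x ->
    integralOver (adjoin f (f d)^-1) (adjoin f x p).
  move=> ix; rewrite adjoinE; apply: integral_horner ix.
  apply/integral_poly => i; rewrite coef_map /= -(adjoinC f (f d)^-1 p`_i).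
  exact: integral_id.
have /(algebraicV e0)/algebraic_integral[c c0 inte] :=
  integral_algebraic_over b0 (intC b e intx).
exists (c * b); first by rewrite rmorphM mulf_neq0.
move=> a a0; pose B := (f (c * b))^-1; rewrite -/B.
have ix : integralOver (adjoin f B) x by exact: (integral_adjoinV_mull b0 c0 intx).
have ie : integralOver (adjoin f B) (adjoin f x e)^-1.
  by rewrite /B mulrC; apply: integral_adjoinV_mull.
have [|p Ep] := He a%:P; first by rewrite /= adjoinC.
rewrite /= adjoinC in Ep.
have [P Pm /rootP Pu] : integralOver (adjoin f B) (f a)^-1.
  rewrite Ep adjoinE; apply: integral_horner ie.
  by apply/integral_poly => i; rewrite coef_map; apply: intC.
have [n sP] : exists n, size P = n.+1.
  by exists (size P).-1; rewrite prednK // size_poly_gt0 monic_neq0.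
have lc : P`_n = 1 by move/monicP: Pm; rewrite lead_coefE sP.
have sg : size (map_poly (adjoin f B) P) = n.+1.
  by rewrite size_map_poly_id0 // (monicP Pm) rmorph1 oner_eq0.
case: n sP lc sg => [|n] sP lc sg.
  move: Pu; rewrite horner_coef sg big_ord1 coef_map /= lc rmorph1 mulr1 => /eqP.
  by rewrite oner_eq0.
(* Multiply the integral equation for u = 1 / a by a ^ n and solve for u. *)
exists (- \sum_(i < n.+1) P`_i * (a ^+ (n - i))%:P).
move: Pu; rewrite horner_coef sg big_ord_recr /= coef_map /= lc rmorph1 mul1r => /eqP.
rewrite addrC addr_eq0 => /eqP /(congr1 (fun z => z * f a ^+ n)).
rewrite exprS -mulrA exprVn mulVf ?expf_neq0 // mulr1 => ->.
rewrite rmorphN rmorph_sum mulNr mulr_suml; congr (- _); apply: eq_bigr => i _.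
rewrite rmorphM /= adjoinC coef_map /= -mulrA rmorphXn; congr (_ * _).
by rewrite exprB ?unitfE ?leq_ord // mulrC exprVn.
Qed.

(** Generation is expressed by a tower of polynomial rings mapping to L, so that
    generators can be removed one at a time. *)
Fixpoint finitely_generated (R : comNzRingType) (f : {rmorphism R -> L})
    (xs : seq L) : Prop :=
  if xs is x :: xs' then finitely_generated (adjoin f x) xs'
  else forall z, exists r, z = f r.

Lemma finitely_generated_inverse (R : comNzRingType) (f : {rmorphism R -> L}) xs :
  finitely_generated f xs -> inverse_generated f.
Proof.
elim: xs R f => [|x xs IH] R f /= H; last exact/inverse_generated_descent/IH/H.
exists 1; first by rewrite rmorph1 oner_eq0.
by move=> a _; have [r ->] := H (f a)^-1; exists r%:P; rewrite adjoinC.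
Qed.

(** By descent Goldman's condition passes from L, where it is trivial, down to
    R[x], where it excludes that x is transcendental. *)
Lemma zariski (R : comNzRingType) (f : {rmorphism R -> L}) x xs :
  finitely_generated f (x :: xs) -> algebraic_over f x.
Proof.
by move=> H; apply/inverse_generated_adjoin/(finitely_generated_inverse (xs := xs)).
Qed.

End AdjoinTower.

(** * The residue field and the Nullstellensatz *)

Section ResidueField.
Context (A : comNzRingType) (m : idealr A) (mx : maximal_ideal m).

(** The maximality proof is an index of the type, so that the field structure
    can be attached to it. *)
Definition residue_field of maximal_ideal m : Type := {ideal_quot m}.
Local Notation F := (residue_field mx).
HB.instance Definition _ := GRing.ComNzRing.on F.

Lemma residue_field_inv_exists (x : F) : exists y : F,
  (x != 0 -> y * x = 1) /\ (x = 0 -> y = 0).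
Proof.
have [x0|x0] := eqVneq x 0; first by exists 0; split=> //; rewrite x0 eqxx.
have xm : repr (x : {ideal_quot m}) \notin m.
  apply: contra x0 => xm; apply/eqP; rewrite -[LHS]reprK -[RHS](rmorph0 \pi_{ideal_quot m}).
  by apply/eqP; rewrite piE /= Quotient.equivE subr0.
have [b hb] := maximal_ideal_inv mx xm.
exists (\pi_{ideal_quot m} b : F); split => [_ | x0']; last by rewrite x0' eqxx in x0.
rewrite -[x]reprK -[RHS](rmorph1 \pi_{ideal_quot m}) -[LHS](rmorphM \pi_{ideal_quot m}).
by apply/eqP; rewrite piE /= Quotient.equivE -opprB rpredN.
Qed.

Definition residue_field_inv (x : F) : F := projT1 (cid (residue_field_inv_exists x)).

Lemma residue_field_mulVf (x : F) : x != 0 -> residue_field_inv x * x = 1.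
Proof. exact: (projT2 (cid (residue_field_inv_exists x))).1. Qed.

Lemma residue_field_inv0 : residue_field_inv 0 = 0.
Proof. exact: (projT2 (cid (residue_field_inv_exists 0))).2. Qed.

HB.instance Definition _ :=
  GRing.ComNzRing_isField.Build F residue_field_mulVf residue_field_inv0.

Definition to_residue : A -> F := \pi_{ideal_quot m}.
HB.instance Definition _ := GRing.RMorphism.on to_residue.

Lemma to_residue_surj (x : F) : exists a, x = to_residue a.
Proof. by exists (repr (x : {ideal_quot m})); rewrite /to_residue reprK. Qed.

Lemma to_residue_eq0 a : (to_residue a = 0) <-> (a \in m).
Proof.
rewrite -(rmorph0 to_residue) /to_residue; split=> [/eqP|h].
  by rewrite piE /= Quotient.equivE subr0.
by apply/eqP; rewrite piE /= Quotient.equivE subr0.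
Qed.

End ResidueField.

Section Nullstellensatz.
Context (K : fieldType) (N : nat) (A : comNzRingType).
Context (phi : {rmorphism {mpoly K[N]} -> A}) (phi_surj : forall a, exists f, a = phi f).
Context (m : idealr A) (mx : maximal_ideal m).

Definition upoly (j : 'I_N) (g : {poly K}) : {mpoly K[N]} :=
  (map_poly (@mpolyC N K) g).['X_j].

Let rho := (@to_residue A m mx \o phi : {rmorphism _ -> _}).
Let rhoC := (rho \o (@mpolyC N K) : {rmorphism _ -> _}).

Lemma finitely_generated_residue (xs : seq (residue_field mx)) :
  (forall j : 'I_N, rho 'X_j \in xs) -> finitely_generated rhoC xs.
Proof.
(* What the induction on js carries along: either the current ring already maps
   onto the residue field, or its image contains K and the classes of all
   variables that are not listed in js. *)
have gen (js : seq (residue_field mx)) (R : comNzRingType)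
      (f : {rmorphism R -> residue_field mx}) :
    (forall z, exists p, z = f p) \/
    ((forall c, exists r, rhoC c = f r) /\
     (forall j : 'I_N, (exists r, rho 'X_j = f r) \/ rho 'X_j \in js)) ->
    finitely_generated f js.
  elim: js R f => [|y js IH] R f /=.
    case=> // -[HC HX] z.
    have [a ->] := to_residue_surj z; have [p ->] := phi_surj a; rewrite -[to_residue _ _]/(rho p).
    elim/mpolyind: p => [|c mm p _ _ [r Er]]; first by exists 0; rewrite !rmorph0.
    rewrite rmorphD Er -mul_mpolyC rmorphM /=.
    have [rc Erc] := HC c.
    suff [rm Erm] : exists rm, rho 'X_[mm] = f rm.
      by exists (rc * rm + r); rewrite rmorphD rmorphM /= -Erc -Erm.
    rewrite mpolyXE_id rmorph_prod.
    have HX' j : exists r, rho 'X_j = f r by case: (HX j).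
    have [g Hg] := choice HX'.
    exists (\prod_j g j ^+ mm j); rewrite rmorph_prod; apply: eq_bigr => j _.
    by rewrite !rmorphXn Hg.
  case=> [H|[HC HX]]; apply: IH.
    by left=> z; have [p ->] := H z; exists p%:P; rewrite /= adjoinC.
  right; split=> [c|j]; first have [r Er] := HC c.
    by exists r%:P; exact: (etrans Er (esym (adjoinC f y r))).
  have [[r Er]|] := HX j.
    by left; exists r%:P; exact: (etrans Er (esym (adjoinC f y r))).
  rewrite inE => /orP[/eqP Ey|]; last by right.
  by left; exists 'X; exact: (etrans Ey (esym (adjoinX f y))).
move=> H; apply: gen; right; split=> [c|j]; first by exists c.
by right.
Qed.

(** The residue field is finitely generated as a ring over K, so the class of
    each variable is algebraic over K; its equation lies in the maximal ideal. *)
Lemma nullstellensatz (j : 'I_N) :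
  exists2 g : {poly K}, g \is monic & phi (upoly j g) \in m.
Proof.
pose xs := [seq rho 'X_i | i <- enum 'I_N].
have fg : finitely_generated rhoC (rho 'X_j :: xs).
  apply: finitely_generated_residue => i; rewrite inE; apply/orP; right.
  by apply/mapP; exists i; rewrite ?mem_enum.
have [q q0 /rootP qx] := zariski fg.
have q0' : q != 0 by apply: contraNneq q0 => ->; rewrite rmorph0.
exists ((lead_coef q)^-1 *: q).
  by rewrite monicE lead_coefZ mulVf // lead_coef_eq0.
apply/(to_residue_eq0 mx); rewrite -[to_residue _ _]/(rho _).
rewrite /upoly map_polyZ hornerZ rmorphM /= -[to_residue _ _]/(rho _).
rewrite -[X in _ * X]/(rho _) -horner_map -map_poly_comp.
by rewrite [X in _ * X]qx mulr0.
Qed.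

End Nullstellensatz.

(** * Weakly regular sequences *)

Section WeakRegularity.
Context (A : comNzRingType).
Implicit Types (I : A -> Prop) (a b w x : A) (xs : seq A).

Definition add_gen I w : A -> Prop := fun a => exists b, I (a - b * w).
Definition colon I w : A -> Prop := fun a => I (w * a).

(** Unlike for regular sequences, the quotients may vanish.  This makes the
    notion stable under localization and under extensions of quotients. *)
Fixpoint weakly_regular I xs : Prop :=
  if xs is x :: xs' then (forall a, I (x * a) -> I a) /\ weakly_regular (add_gen I x) xs'
  else True.

Lemma pred_ext (I J : A -> Prop) : (forall a, I a <-> J a) -> I = J.
Proof. by move=> h; apply/funext => a; apply/propext. Qed.

Lemma add_gen_ideal I w : ideal_pred I -> ideal_pred (add_gen I w).
Proof.
move=> [I0 ID IM]; split; first by exists 0; rewrite mul0r subr0.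
  move=> a b [c hc] [e he]; exists (c + e).
  by rewrite mulrDl opprD addrACA; exact: ID.
by move=> c a [b hb]; exists (c * b); rewrite -mulrA -mulrBr; exact: IM.
Qed.

Lemma add_gen_sub I w a : I a -> add_gen I w a.
Proof. by exists 0; rewrite mul0r subr0. Qed.

Lemma add_gen_mem I w b : ideal_pred I -> add_gen I w (b * w).
Proof. by case=> I0 _ _; exists b; rewrite subrr. Qed.

Lemma add_genC I x y : add_gen (add_gen I x) y = add_gen (add_gen I y) x.
Proof.
apply: pred_ext => a; split=> -[b [c h]]; exists c, b; by rewrite addrAC.
Qed.

Lemma add_gen_eq I x y : ideal_pred I -> I (x - y) -> add_gen I x = add_gen I y.
Proof.
move=> II hxy.
have h u v b a : I (u - v) -> I (a - b * u) -> I (a - b * v).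
  move=> huv ha; have [_ ID IM] := II.
  have -> : a - b * v = (a - b * u) + b * (u - v) by ring.
  by apply: ID => //; exact: IM.
apply: pred_ext => a; split=> -[b hb]; exists b; first exact: (h x).
by apply: (h y) => //; rewrite -opprB; exact: ideal_predN.
Qed.

Lemma weakly_regular_full I xs : (forall a, I a) -> weakly_regular I xs.
Proof.
elim: xs I => //= x xs IH I h; split => // ; apply: IH => a.
exact: add_gen_sub.
Qed.

(** A / (I : w) and A / (I + (w)) are the outer terms of a short exact sequence
    with middle term A / I; the regularity on A / (I + (w)) keeps it exact when
    the elements of the sequence are factored out one after the other. *)
Lemma weakly_regular_extension I w xs : ideal_pred I ->
  weakly_regular (add_gen I w) xs -> weakly_regular (colon I w) xs ->
  weakly_regular I xs.
Proof.
elim: xs I => //= x xs IH I II [rx rxs] [qx qxs]; have [I0 ID IM] := II.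
split.
  move=> a ha; have [b hb] : add_gen I w a by apply/rx/add_gen_sub.
  have : colon I w b.
    apply: qx; rewrite /colon.
    have -> : w * (x * b) = x * a - x * (a - b * w) by ring.
    by apply: ideal_predB => //; exact: IM.
  rewrite /colon => hwb; have -> : a = (a - b * w) + w * b by ring.
  exact: ID.
apply: IH.
- exact: add_gen_ideal.
- by rewrite add_genC.
suff -> : colon (add_gen I x) w = add_gen (colon I w) x by [].
apply: pred_ext => a; rewrite /colon; split=> -[c hc]; last first.
  by exists (w * c); rewrite -mulrA -mulrBr.
have [b hb] : add_gen I w c.
  apply: rx; exists a; rewrite [a * w]mulrC -opprB [x * c]mulrC; exact: ideal_predN.
exists b.
have -> : w * (a - b * x) = (w * a - c * x) + x * (c - b * w) by ring.
by apply: ID => //; exact: IM.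
Qed.

End WeakRegularity.

Section ElementarySymmetric.
Context (A : comNzRingType) (T : finType) (y : T -> A).

Definition elem_sym (k : nat) : A := \sum_(B : {set T} | #|B| == k) \prod_(j in B) y j.

(** The highest degree comes first: it is the one that becomes a product of
    nonzerodivisors once all but d of the y_j vanish. *)
Fixpoint elem_syms (d : nat) : seq A :=
  if d is d'.+1 then elem_sym d :: elem_syms d' else [::].

Context (q : T -> A) (F : pred T).

Definition span_of (js : seq T) : A -> Prop :=
  foldr (fun j I => add_gen I (q j)) (fun a => a = 0) js.

Lemma span_of_ideal js : ideal_pred (span_of js).
Proof.
elim: js => [|j js IH]; last exact: add_gen_ideal.
by split=> //= [a b -> ->|c a ->]; rewrite ?addr0 ?mulr0.
Qed.

Lemma span_of_mem js j b : j \in js -> span_of js (b * q j).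
Proof.
elim: js => //= i js IH; rewrite inE => /orP[/eqP ->|/IH]; last exact: add_gen_sub.
exact/add_gen_mem/span_of_ideal.
Qed.

Hypothesis (yq : forall j, exists c, y j = c * q j).
Hypothesis (q_reg : forall js l a, uniq js -> l \notin js ->
  span_of js (q l * a) -> span_of js a).
Hypothesis (q_y : forall j, ~~ F j -> q j = y j).

(** A product over d indices other than the complement of js involves an index
    in js, and so vanishes modulo the span. *)
Lemma elem_sym_mod js d : uniq js -> (size js + d)%N = #|T| ->
  span_of js (elem_sym d - \prod_(j <- [seq j <- enum T | j \notin js]) y j).
Proof.
move=> ujs szd; have [_ ID IM] := span_of_ideal js.
rewrite big_filter big_enum_cond /= /elem_sym.
pose C : {set T} := ~: [set j in js].
have cC : #|C| == d.
  have := cardsC [set j in js]; rewrite cardsE (card_uniqP ujs) -szd => /eqP.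
  by rewrite eqn_add2l.
rewrite (bigD1 C) //= [X in _ - X](eq_bigl (fun j => j \in C)); last first.
  by move=> j; rewrite !inE.
rewrite addrAC subrr add0r.
have [I0 _ _] := span_of_ideal js.
elim/big_ind: _ => [//|a b|B /andP[/eqP cB BC]]; first exact: ID.
have [j jB jC] : exists2 j, j \in B & j \notin C.
  apply/subsetPn; apply: contra BC => sBC.
  by rewrite eqEcard sBC cB (eqP cC) /=.
rewrite (bigD1 j) //=; have [c ->] := yq j.
rewrite mulrAC; apply: span_of_mem; move: jC; rewrite !inE negbK //.
Qed.

(** Modulo the span, e_(d+1) is the product of the y_j with j outside js.  This
    product is a nonzerodivisor, and peeling off its factors filters the
    quotient by quotients modulo one further y_j, to which the induction
    hypothesis for d applies. *)
Lemma elem_syms_regular d js : uniq js -> {subset F <= js} ->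
  (size js + d)%N = #|T| -> weakly_regular (span_of js) (elem_syms d).
Proof.
elim: d js => //= d IH js ujs Fjs szd.
have II := span_of_ideal js; have em := elem_sym_mod ujs szd.
set cs := filter _ _ in em.
have csP j : j \in cs -> j \notin js by rewrite mem_filter => /andP[].
move: cs csP em => cs csP em.
have yreg j a : j \notin js -> span_of js (y j * a) -> span_of js a.
  move=> jn; rewrite -q_y; first exact: q_reg.
  by apply: contra jn => /Fjs.
split.
  move=> a ha.
  have {ha} : span_of js (\prod_(j <- cs) y j * a).
    rewrite -[X in X * a](subKr (elem_sym d.+1)) mulrBl.
    apply: ideal_predB => //; by rewrite mulrC; case: II => _ _; apply.
  elim: cs csP {em} => [|j cs IHc] csP; first by rewrite big_nil mul1r.
  rewrite big_cons -mulrA => /yreg h; apply: IHc.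
    by move=> i ic; apply: csP; rewrite inE ic orbT.
  by apply: h; apply: csP; rewrite mem_head.
rewrite (add_gen_eq II em).
elim: cs csP {em} => [|j cs IHc] csP.
  rewrite big_nil; apply: weakly_regular_full => a; exists a.
  by rewrite mulr1 subrr; case: II.
have jn : j \notin js by apply: csP; rewrite mem_head.
rewrite big_cons; apply: (@weakly_regular_extension _ _ (y j)).
- exact: add_gen_ideal.
- rewrite add_genC.
  have -> : add_gen (add_gen (span_of js) (y j)) (y j * \prod_(j0 <- cs) y j0) =
            span_of (j :: js).
    rewrite /= q_y; last by apply: contra jn => /Fjs.
    apply: pred_ext => a; split=> [[b [c h]]|]; last exact: add_gen_sub.
    exists (c + b * \prod_(j0 <- cs) y j0).
    rewrite [X in span_of _ X](_ : _ = a - b * (y j * \prod_(j0 <- cs) y j0) - c * y j) //.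
    ring.
  apply: IH => /=; first by rewrite jn.
    by move=> i /Fjs; rewrite inE orbC => ->.
  by rewrite -szd addnS.
have -> : colon (add_gen (span_of js) (y j * \prod_(j0 <- cs) y j0)) (y j) =
          add_gen (span_of js) (\prod_(j0 <- cs) y j0).
  apply: pred_ext => a; rewrite /colon; split=> -[b h]; exists b.
    by apply: (yreg j) => //; rewrite mulrBr mulrCA.
  by rewrite mulrCA -mulrBr; case: II => _ _; apply.
by apply: IHc => i ic; apply: csP; rewrite inE ic orbT.
Qed.

End ElementarySymmetric.

(** * Ideals generated by univariate polynomials *)

Import Pdiv.CommonRing Pdiv.RingMonic.

Section Univariate.
Context (K : fieldType) (N : nat).
Local Notation S := {mpoly K[N]}.
Implicit Types (i j l : 'I_N) (f : S) (g : {poly K}).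

Lemma mpoly_rmorph_ext (B : nzRingType) (phi psi : {rmorphism S -> B}) :
  (forall c, phi c%:MP = psi c%:MP) -> (forall i, phi 'X_i = psi 'X_i) ->
  phi =1 psi.
Proof.
move=> hC hX; elim/mpolyind => [|c m p _ _ IH]; first by rewrite !rmorph0.
rewrite !rmorphD IH -mul_mpolyC !rmorphM /= hC mpolyXE_id !rmorph_prod /=.
by congr (_ * _ + _); apply: eq_bigr => i _; rewrite !rmorphXn hX.
Qed.

(** Polynomials viewed as polynomials in x_j whose coefficients do not involve
    x_j; these coefficients are kept in the same ring. *)
Definition isolate j : S -> {poly S} :=
  mmap (polyC \o @mpolyC N K) (fun i => if i == j then 'X else ('X_i)%:P).
HB.instance Definition _ j := GRing.RMorphism.on (isolate j).

Lemma isolateC j c : isolate j c%:MP = c%:MP%:P.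
Proof. by rewrite /isolate mmapC. Qed.

Lemma isolateX j i : isolate j 'X_i = if i == j then 'X else ('X_i)%:P.
Proof. by rewrite /isolate mmapX mmap1U. Qed.

Lemma isolate_upoly j l g :
  isolate j (upoly l g) = if l == j then map_poly (@mpolyC N K) g else (upoly l g)%:P.
Proof.
rewrite /upoly -horner_map /= -map_poly_comp isolateX.
have -> : map_poly (isolate j \o @mpolyC N K) g = map_poly polyC (map_poly (@mpolyC N K) g).
  by rewrite -map_poly_comp; apply: eq_map_poly => c /=; rewrite isolateC.
case: eqP => _; last by rewrite horner_map.
by rewrite -[RHS]comp_polyXr.
Qed.

Lemma isolate_horner j f : (isolate j f).['X_j] = f.
Proof.
have := @mpoly_rmorph_ext _ (horner_eval 'X_j \o isolate j) idfun.
apply=> [c|i] /=; first by rewrite isolateC /horner_eval hornerC.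
rewrite isolateX /horner_eval; case: eqP => [->|_]; by rewrite (hornerX, hornerC).
Qed.

(** The remainder of the division by g(x_j). *)
Definition reduce j g f : S :=
  (rmodp (isolate j f) (map_poly (@mpolyC N K) g)).['X_j].

Context (q : 'I_N -> {poly K}) (q_monic : forall j, q j \is monic).

Let qS_monic j : map_poly (@mpolyC N K) (q j) \is monic.
Proof. exact: monic_map. Qed.

Lemma reduceB j f f' : reduce j (q j) (f - f') = reduce j (q j) f - reduce j (q j) f'.
Proof. by rewrite /reduce rmorphB rmodpB // hornerD hornerN. Qed.

Lemma reduceM j l f : l != j ->
  reduce j (q j) (upoly l (q l) * f) = upoly l (q l) * reduce j (q j) f.
Proof.
move=> lj; rewrite /reduce rmorphM /= isolate_upoly (negPf lj) mul_polyC rmodpZ //.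
by rewrite hornerZ.
Qed.

Lemma reduce_mul j f : reduce j (q j) (f * upoly j (q j)) = 0.
Proof.
by rewrite /reduce rmorphM /= isolate_upoly eqxx rmodp_mull // horner0.
Qed.

Lemma reduce_sub j f : exists b, f - reduce j (q j) f = b * upoly j (q j).
Proof.
exists (rdivp (isolate j f) (map_poly (@mpolyC N K) (q j))).['X_j].
rewrite -{1}(isolate_horner j f) {1}(rdivp_eq (qS_monic j) (isolate j f)).
by rewrite hornerD hornerM addrK.
Qed.

Local Notation span := (span_of (fun j => upoly j (q j))).

Definition normal_form (js : seq 'I_N) (f : S) : S :=
  foldr (fun j => reduce j (q j)) f js.

Lemma normal_formB js f f' :
  normal_form js (f - f') = normal_form js f - normal_form js f'.
Proof. by elim: js => //= j js ->; rewrite reduceB. Qed.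

Lemma normal_formM js l f : l \notin js ->
  normal_form js (upoly l (q l) * f) = upoly l (q l) * normal_form js f.
Proof.
elim: js => //= j js IH; rewrite inE negb_or => /andP[lj /IH ->].
by rewrite reduceM.
Qed.

(** The remainders are linear over polynomials in the other variables, so each
    reduction preserves the ideal generated by the previous ones. *)
Lemma normal_form_eq0 js f : uniq js -> span js f <-> normal_form js f = 0.
Proof.
have sub jt h : span jt (h - normal_form jt h).
  elim: jt => [|j jt IH] /=; first by rewrite subrr.
  have [b hb] := reduce_sub j (normal_form jt h).
  exists b; rewrite -hb.
  by rewrite [X in span _ X](_ : _ = h - normal_form jt h) //; ring.
move=> ujs; split=> [|nf]; last by have := sub js f; rewrite nf subr0.
elim: js f ujs => //= j js IH f /andP[jn ujs] [b /IH -/(_ ujs) hb].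
move: hb; rewrite normal_formB [b * _]mulrC normal_formM // => /eqP.
by rewrite subr_eq0 => /eqP ->; rewrite mulrC reduce_mul.
Qed.

Lemma upoly_neq0 j g : g != 0 -> upoly j g != 0.
Proof.
move=> g0; apply: contraNneq g0 => h.
have /eqP := isolate_upoly j j g; rewrite eqxx h rmorph0 eq_sym => /eqP E.
apply/eqP/polyP => i; rewrite coef0; have /(congr1 (fun p : {poly S} => p`_i)) := E.
by rewrite coef0 coef_map /= => /eqP; rewrite mpolyC_eq0 => /eqP.
Qed.

(** Normal forms with respect to js commute with the multiplication by a
    polynomial in x_l, which is injective since the ring is a domain. *)
Lemma upoly_regular js l f : uniq js -> l \notin js ->
  span js (upoly l (q l) * f) -> span js f.
Proof.
move=> ujs ln /(normal_form_eq0 _ ujs) h; apply/(normal_form_eq0 _ ujs)/eqP.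
move/eqP: h; rewrite normal_formM // mulf_eq0 (negPf (upoly_neq0 _ _)) //.
exact: monic_neq0.
Qed.

End Univariate.

(** * Ideals generated by variables *)

Section VariableIdeals.
Context (K : fieldType) (N : nat).
Local Notation S := {mpoly K[N]}.
Implicit Types (F : {set 'I_N}) (f : S) (m : 'X_{1..N}).

Definition kill F : S -> S :=
  mmap (@mpolyC N K) (fun i => if i \in F then 0 else 'X_i).
HB.instance Definition _ F := GRing.RMorphism.on (kill F).

(** Defined as the kernel of an endomorphism of a domain, the ideal is visibly
    prime. *)
Definition var_ideal F f : Prop := kill F f = 0.

Lemma killC F c : kill F c%:MP = c%:MP.
Proof. by rewrite /kill mmapC. Qed.

Lemma kill_var F i : kill F 'X_i = if i \in F then 0 else 'X_i.
Proof. by rewrite /kill mmapX mmap1U. Qed.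

Lemma kill_monomial F m :
  kill F 'X_[m] = if [exists i in F, (0 < m i)%N] then 0 else 'X_[m].
Proof.
rewrite mpolyXE_id rmorph_prod /=; case: ifPn => [/existsP[i /andP[iF mi]]|].
  by rewrite (bigD1 i) //= rmorphXn /= kill_var iF expr0n eqn0Ngt mi mul0r.
rewrite negb_exists => /forallP h; apply: eq_bigr => i _.
rewrite rmorphXn /= kill_var; case: ifP => // iF.
by have := h i; rewrite iF /= -eqn0Ngt => /eqP ->; rewrite !expr0.
Qed.

Lemma killU F G f : kill F (kill G f) = kill (F :|: G) f.
Proof.
have := @mpoly_rmorph_ext K N _ (kill F \o kill G) (kill (F :|: G)); apply => [c|i] /=.
  by rewrite !killC.
rewrite !kill_var inE; case: (i \in G); rewrite ?rmorph0 ?orbT //.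
by rewrite kill_var orbF.
Qed.

Lemma var_ideal_ideal F : ideal_pred (var_ideal F).
Proof.
rewrite /var_ideal; split; first by rewrite rmorph0.
  by move=> a b ha hb; rewrite rmorphD /= ha hb addr0.
by move=> c a ha; rewrite rmorphM /= ha mulr0.
Qed.

Lemma var_ideal_prime F : prime_pred (var_ideal F).
Proof.
split; first exact: var_ideal_ideal.
  by rewrite /var_ideal rmorph1 => /eqP; rewrite oner_eq0.
move=> a b /eqP; rewrite rmorphM /= mulf_eq0 => /orP[] /eqP; by [left | right].
Qed.

Lemma var_ideal_var F i : var_ideal F 'X_i <-> i \in F.
Proof.
rewrite /var_ideal kill_var; case: ifP => // _; split=> // /(congr1 (mcoeff U_(i)%MM)).
by rewrite mcoeffX eqxx mcoeff0 => /eqP; rewrite oner_eq0.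
Qed.

Lemma mcoeff_kill F f m :
  (kill F f)@_m = if [exists i in F, (0 < m i)%N] then 0 else f@_m.
Proof.
rewrite {1}(mpolyE f) rmorph_sum /= [in RHS](mpolyE f) !raddf_sum /=.
transitivity (\sum_(m' <- msupp f)
    if [exists i in F, (0 < m i)%N] then 0 else (f@_m' *: 'X_[m'])@_m); last first.
  by case: ifP => _ //; rewrite big1.
apply: eq_bigr => m' _; rewrite -mul_mpolyC rmorphM /= killC kill_monomial.
have [<-|ne] := eqVneq m' m.
  by case: ifP; rewrite ?mulr0 ?mcoeff0.
have z : ((f@_m')%:MP * 'X_[m'])@_m = 0.
  by rewrite mul_mpolyC mcoeffZ mcoeffX (negPf ne) mulr0.
by rewrite z if_same; case: ifP; rewrite ?mulr0 ?mcoeff0.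
Qed.

Lemma kill_support F f m i : m \in msupp (kill F f) -> i \in F -> m i = 0%N.
Proof.
rewrite mcoeff_msupp mcoeff_kill; case: ifPn => [|+ _ iF]; first by rewrite eqxx.
by rewrite negb_exists_in => /forall_inP/(_ i iF); rewrite -eqn0Ngt => /eqP.
Qed.

Lemma var_ideal_support F f :
  var_ideal F f <-> forall m, m \in msupp f -> exists2 i, i \in F & (0 < m i)%N.
Proof.
split=> [h m|h].
  rewrite mcoeff_msupp => fm; apply/exists_inP; apply: contraR fm => nF.
  by have := mcoeff_kill F f m; rewrite h mcoeff0 (negPf nF) => <-.
apply/mpolyP => m; rewrite mcoeff_kill mcoeff0; case: ifPn => // nF.
apply: memN_msupp_eq0; apply: contra nF => /h[i iF mi].
by apply/exists_inP; exists i.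
Qed.

Lemma ideal_sub_kill (I : S -> Prop) F f : ideal_pred I ->
  (forall i, i \in F -> I 'X_i) -> I (f - kill F f).
Proof.
move=> II IF; have [I0 ID IM] := II.
have mono m : I ('X_[m] - kill F 'X_[m]).
  rewrite kill_monomial; case: ifP => [/existsP[i /andP[iF mi]]|]; last by rewrite subrr.
  rewrite subr0; have -> : 'X_[m] = 'X_[m - U_(i)] * 'X_i :> S.
    rewrite -mpolyXD submK //; apply/mnm_lepP => k; rewrite mnm1E.
    by case: eqP => // <-.
  by apply: IM; apply: IF.
rewrite [X in _ - kill _ X](mpolyE f) rmorph_sum /= [X in X - _](mpolyE f) -sumrB.
apply: big_ind => // m _; rewrite -mul_mpolyC rmorphM /= killC -mulrBr.
exact: IM.
Qed.

Lemma var_ideal_gen F f :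
  var_ideal F f <-> ideal_gen (fun h : S => exists2 i, i \in F & h = 'X_i) f.
Proof.
split=> [h|[n [c [g [hg ->]]]]]; last first.
  rewrite /var_ideal rmorph_sum big1 // => i _; have [j jF ->] := hg i.
  by rewrite rmorphM /= kill_var jF mulr0.
have <- : f - kill F f = f by rewrite h subr0.
apply: ideal_sub_kill => [|i iF]; last first.
  by apply: ideal_gen_mem; exists i.
exact: ideal_gen_ideal.
Qed.

End VariableIdeals.

(** * Shelling an intersection of variable ideals *)

Section Shelling.
Context (K : fieldType) (N : nat).
Local Notation S := {mpoly K[N]}.
Implicit Types (F U V : {set 'I_N}) (FF : {set {set 'I_N}}) (f : S).

(** The exchange property of weakly polymatroidal ideals, for squarefree
    generators given by their supports. *)
Definition exchange_family (ord : {perm 'I_N}) FF : Prop :=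
  forall U V, U \in FF -> V \in FF -> forall t : 'I_N,
    (forall k : 'I_N, (k < t)%N -> (ord k \in U) = (ord k \in V)) ->
    ord t \in U -> ord t \notin V ->
    exists l : 'I_N, [/\ (t < l)%N, ord l \in V & ord t |: V :\ ord l \in FF].

Definition facet_ideal FF f : Prop := forall F, F \in FF -> var_ideal F f.

Lemma facet_ideal_ideal FF : ideal_pred (facet_ideal FF).
Proof.
split=> [F _|a b ha hb F FFF|c a ha F FFF].
- by have [] := var_ideal_ideal K F.
- by have [_ D _] := var_ideal_ideal K F; apply: D; [apply: ha | apply: hb].
- by have [_ _ M] := var_ideal_ideal K F; apply: M; apply: ha.
Qed.

Lemma facet_ideal_colon FF (x : 'I_N) :
  colon (facet_ideal FF) 'X_x = facet_ideal [set F in FF | x \notin F].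
Proof.
apply: pred_ext => f; split=> h F.
  rewrite inE => /andP[FFF xF].
  have [_ _ P] := var_ideal_prime K F.
  by have [] := P _ _ (h F FFF) => // /var_ideal_var; rewrite (negPf xF).
move=> FFF; have [_ D M] := var_ideal_ideal K F.
have [xF|xF] := boolP (x \in F); last by apply: M; apply: h; rewrite inE FFF.
by rewrite mulrC; apply: M; apply/var_ideal_var.
Qed.

(** Let x be the variable at position t, let f lie in the ideals of all members
    that contain x, and let V be a member that does not.  Exchanging a later
    variable l of V for x gives a member W containing x with V + x = W + l, so f
    with x set to zero lies in the ideal of V as well. *)
Lemma facet_ideal_add_var ord FF (t : 'I_N) :
  exchange_family ord FF ->
  (forall U V, U \in FF -> V \in FF -> forall k : 'I_N, (k < t)%N ->
     (ord k \in U) = (ord k \in V)) ->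
  (exists2 U, U \in FF & ord t \in U) ->
  add_gen (facet_ideal FF) 'X_(ord t) = facet_ideal [set F in FF | ord t \in F].
Proof.
move=> ex agree [U UF tU]; apply: pred_ext => f; split.
  case=> b h F; rewrite inE => /andP[FFF tF].
  have [_ D M] := var_ideal_ideal K F.
  have -> : f = (f - b * 'X_(ord t)) + b * 'X_(ord t) by rewrite subrK.
  by apply: D; [exact: h | apply: M; apply/var_ideal_var].
move=> h.
have [b hb] : exists b, f - kill [set ord t] f = b * 'X_(ord t).
  have II := add_gen_ideal 'X_(ord t) (span_of_ideal (fun=> 0 : S) ([::] : seq 'I_N)).
  have := @ideal_sub_kill K N _ [set ord t] f II; case.
    by move=> i /set1P ->; exists 1; rewrite mul1r subrr.
  by move=> b /eqP; rewrite subr_eq0 => /eqP; exists b.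
exists b; rewrite -hb subKr => V VF; rewrite /var_ideal killU.
have [tV|tV] := boolP (ord t \in V).
  have -> : V :|: [set ord t] = V by apply/setUidPl; rewrite sub1set.
  by apply: h; rewrite inE VF.
have [l [tl lV WF]] := ex U V UF VF t (agree U V UF VF) tU tV.
have -> : V :|: [set ord t] = [set ord l] :|: (ord t |: V :\ ord l).
  apply/setP => i; rewrite !inE; have [->|] := eqVneq i (ord l); first by rewrite lV.
  by rewrite orbC.
by rewrite -killU h ?rmorph0 // inE WF !inE eqxx.
Qed.

(** An exchange at a later position leaves the membership of x unchanged. *)
Lemma exchange_family_sub ord FF (t : 'I_N) (b : bool) :
  exchange_family ord FF ->
  (forall U V, U \in FF -> V \in FF -> forall k : 'I_N, (k < t)%N ->
     (ord k \in U) = (ord k \in V)) ->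
  exchange_family ord [set F in FF | (ord t \in F) == b].
Proof.
move=> ex agree U V; rewrite !inE => /andP[UF Ut] /andP[VF Vt] t' h tU tV.
have [l [tl lV WF]] := ex U V UF VF t' h tU tV.
exists l; split => //; rewrite inE WF !inE /=.
have tt' : (t < t')%N.
  case: ltngtP => // [t't|/val_inj tt'].
    by move: tV; rewrite -(agree _ _ UF VF _ t't) tU.
  by move: Vt; rewrite -(eqP Ut) tt' tU (negPf tV).
rewrite !(inj_eq perm_inj) -!val_eqE /= (ltn_eqF tt') (ltn_eqF (ltn_trans tt' tl)) /=.
exact: Vt.
Qed.

(** If all members agree before position t, splitting the family by the variable
    at position t gives I : x and I + (x); once they agree everywhere there is
    at most one member left. *)
Lemma facet_ideal_regular ord FF (xs : seq S) :
  exchange_family ord FF ->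
  (forall F, F \in FF -> weakly_regular (var_ideal F) xs) ->
  weakly_regular (facet_ideal FF) xs.
Proof.
suff main m : (m <= N)%N -> forall FF',
    (forall U V, U \in FF' -> V \in FF' -> forall k : 'I_N, (k < N - m)%N ->
      (ord k \in U) = (ord k \in V)) ->
    exchange_family ord FF' ->
    (forall F, F \in FF' -> weakly_regular (var_ideal F) xs) ->
    weakly_regular (facet_ideal FF') xs.
  by apply: (main N) => // U V _ _ k; rewrite subnn.
elim: m => [|m IH] mN {}FF agree ex reg.
  have [->|[F FF0]] := set_0Vmem FF.
    by apply: weakly_regular_full => f F; rewrite inE.
  suff -> : facet_ideal FF = var_ideal F by exact: reg.
  apply: pred_ext => f; split=> [|h G GF]; first exact.
  suff -> : G = F by [].
  apply/setP => i; rewrite -(permKV ord i); apply: agree => //.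
  by rewrite subn0.
have tN : (N - m.+1 < N)%N by lia.
pose t := Ordinal tN.
have agree' : forall U V, U \in FF -> V \in FF -> forall k : 'I_N, (k < t)%N ->
     (ord k \in U) = (ord k \in V) by exact: agree.
have sub_reg b : weakly_regular (facet_ideal [set F in FF | (ord t \in F) == b]) xs.
  apply: IH; first exact: ltnW.
    move=> U V; rewrite !inE => /andP[UF /eqP Ut] /andP[VF /eqP Vt] k kt.
    have [E|ne] := eqVneq (k : nat) t; last by apply: agree => //; move: ne => /=; lia.
    by rewrite (val_inj E : k = t) Ut Vt.
    exact: exchange_family_sub.
  by move=> F; rewrite inE => /andP[/reg].
have [[U UF tU]|none] := pselect (exists2 U, U \in FF & ord t \in U); last first.
  suff <- : [set F in FF | (ord t \in F) == false] = FF by [].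
  apply/setP => F; rewrite inE; have [FFF|] //= := boolP (F \in FF).
  by apply/eqP/negP => tF; apply: none; exists F.
apply: (@weakly_regular_extension _ _ 'X_(ord t)).
- exact: facet_ideal_ideal.
- rewrite (facet_ideal_add_var ex) //; last by exists U.
  by have := sub_reg true; under eq_finset do rewrite eqb_id.
rewrite facet_ideal_colon.
by have := sub_reg false; under eq_finset do rewrite eqbF_neg.
Qed.

Section SystemOfParams.
Context (g : 'I_N -> {poly K}) (g_monic : forall j, g j \is monic).

(** The factor x_j makes the element vanish modulo x_j, the factor g_j puts it
    into any ideal containing g_j(x_j). *)
Definition param_var (j : 'I_N) : S := upoly j ('X * g j).

Lemma param_varE j : param_var j = 'X_j * upoly j (g j).
Proof. by rewrite /param_var /upoly rmorphM /= map_polyX hornerM hornerX. Qed.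

(** Outside F the parameters are monic polynomials in distinct variables, and
    inside F they are multiples of the variables. *)
Lemma var_ideal_params_regular F d : (#|F| + d)%N = N ->
  weakly_regular (var_ideal F) (elem_syms param_var d).
Proof.
move=> Fd; pose q j := if j \in F then 'X else 'X * g j.
have qm j : q j \is monic.
  by rewrite /q; case: ifP => _; rewrite ?monicX // monicMl ?monicX.
have qX j : j \in F -> upoly j (q j) = 'X_j.
  by rewrite /q => ->; rewrite /upoly map_polyX hornerX.
have -> : var_ideal F = span_of (fun j => upoly j (q j)) (enum F).
  apply: pred_ext => f; split=> [h|].
    have <- : f - kill F f = f by rewrite h subr0.
    apply: ideal_sub_kill; first exact: span_of_ideal.
    move=> i iF; rewrite -(mul1r 'X_i) -(qX i) //.
    by apply: (span_of_mem (fun j => upoly j (q j))); rewrite mem_enum.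
  have : forall j, j \in enum F -> j \in F by move=> j; rewrite mem_enum.
  elim: (enum F) f => [|j js IH] f hjs /=; first by move=> ->; rewrite /var_ideal rmorph0.
  case=> b /IH h; have -> : f = (f - b * upoly j (q j)) + b * upoly j (q j) by rewrite subrK.
  have [_ D M] := var_ideal_ideal K F; apply: D.
    by apply: h => i ij; apply: hjs; rewrite inE ij orbT.
  apply: M; have jF : j \in F by apply: hjs; rewrite mem_head.
  by rewrite qX //; apply/var_ideal_var.
apply: (@elem_syms_regular _ _ _ _ (mem F)).
- move=> j; rewrite param_varE /q; case: ifP => jF; last first.
    by exists 1; rewrite mul1r -param_varE.
  by exists (upoly j (g j)); rewrite /upoly map_polyX hornerX mulrC.
- by move=> js l a; apply: upoly_regular.
- by move=> j; rewrite /q inE => /negPf ->.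
- exact: enum_uniq.
- by move=> j; rewrite mem_enum.
- by rewrite -cardE card_ord.
Qed.

End SystemOfParams.
End Shelling.

(** * Chains of primes and algebraic independence *)

Section Words.
Context (K : fieldType) (A : comNzRingType) (kap : {rmorphism K -> A}) (k : nat).

(** Words are the exponent vectors with entries below k. *)
Fixpoint words (n : nat) : seq (seq 'I_k) :=
  if n is n'.+1 then [seq e :: w | e <- enum 'I_k, w <- words n'] else [:: [::]].

Lemma size_words n : size (words n) = (k ^ n)%N.
Proof. by elim: n => //= n IH; rewrite size_allpairs size_enum_ord IH expnS. Qed.

Lemma mem_words n w : (w \in words n) = (size w == n).
Proof.
elim: n w => [|n IH] w /=; first by case: w.
apply/allpairsP/eqP => [[[e v] /= [_ + ->]]|].
  by rewrite IH => /eqP <-.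
case: w => // e v [sv]; exists (e, v); split=> //=; first by rewrite mem_enum.
by rewrite IH sv.
Qed.

Lemma uniq_words n : uniq (words n).
Proof.
elim: n => //= n IH; apply: allpairs_uniq => //; first exact: enum_uniq.
by move=> [e v] [e' v'] _ _ /= [-> ->].
Qed.

Definition word_eval (zs : seq A) (w : seq 'I_k) : A :=
  \prod_(x <- zip zs w) x.1 ^+ x.2.

Definition words_eval (c : seq 'I_k -> K) (zs : seq A) : A :=
  \sum_(w <- words (size zs)) kap (c w) * word_eval zs w.

Lemma words_eval_cons c z zs :
  words_eval c (z :: zs) = \sum_(e < k) z ^+ e * words_eval (fun w => c (e :: w)) zs.
Proof.
rewrite /words_eval /= big_allpairs_dep big_enum /=; apply: eq_bigr => e _.
rewrite mulr_sumr; apply: eq_bigr => w _.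
by rewrite /word_eval /= big_cons /= mulrCA.
Qed.

(** Suppose the value of the polynomial lies in the first prime and let e be the
    lowest exponent of z_0 in it.  As z_0 is outside that prime, the factor
    z_0 ^ e can be cancelled; as z_0 is in the second prime, the coefficient of
    z_0 ^ e, a polynomial in z_1, z_2, ..., then lies in the second prime. *)
Lemma chain_independent n (Pr : nat -> A -> Prop) (z : nat -> A) c :
  (forall i, prime_pred (Pr i)) ->
  (forall i a, (i < n)%N -> Pr i a -> Pr i.+1 a) ->
  (forall i, (i < n)%N -> Pr i.+1 (z i) /\ ~ Pr i (z i)) ->
  Pr 0%N (words_eval c (mkseq z n)) -> forall w, size w = n -> c w = 0.
Proof.
elim: n Pr z c => [|n IH] Pr z c Pp sub zP h w.
  move/size0nil ->; move: h; rewrite /words_eval /= big_seq1 /word_eval /= big_nil mulr1.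
  have [[_ _ IM] n1 _] := Pp 0%N.
  move=> /(IM (kap (c [::])^-1)); rewrite -rmorphM /=.
  have [-> //|c0] := eqVneq (c [::]) 0.
  by rewrite mulVf // rmorph1 => /n1.
have [II n1 PM] := Pp 0%N; have [I0 ID IM] := II.
have mkE : mkseq z n.+1 = z 0%N :: mkseq (fun i => z i.+1) n.
  by rewrite /mkseq /= -[1%N]addn0 iotaDl -map_comp.
rewrite mkE words_eval_cons in h.
set zs := mkseq _ n in h.
case: w => // e w [sw].
elim/ltn_ind: {e}(e : nat) {-2}e (erefl (e : nat)) w sw => e0 IHe e Ee w sw.
have low (e' : 'I_k) : (e' < e0)%N -> words_eval (fun w => c (e' :: w)) zs = 0.
  move=> lt; rewrite /words_eval big_seq big1 // => v; rewrite mem_words size_mkseq.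
  by move=> /eqP sv; rewrite (IHe _ lt e' (erefl _) v sv) rmorph0 mul0r.
apply: (IH (fun i => Pr i.+1) (fun i => z i.+1) (fun w => c (e :: w))) => //.
- by move=> i a lt; apply: sub.
- by move=> i lt; apply: zP.
have [z1 z0] := zP 0%N isT.
move: h; rewrite (bigID (fun e' : 'I_k => (e' < e0)%N)) /= big1 ?add0r; last first.
  by move=> e' /low ->; rewrite mulr0.
rewrite (bigD1 e) ?Ee ?ltnn //= -/zs.
set t := words_eval _ zs; set R := \sum_(_ | _) _ => h.
have [r Er] : exists r, R = z 0%N ^+ e0 * (z 0%N * r).
  exists (\sum_(i < k | ~~ (i < e0)%N && (i != e))
            z 0%N ^+ (i - e0).-1 * words_eval (fun w => c (i :: w)) zs).
  rewrite !mulr_sumr; apply: eq_bigr => i /andP[ie ne].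
  rewrite !mulrA; congr (_ * _); rewrite -mulrA -exprS -exprD; congr (_ ^+ _).
  by move: ie ne; rewrite -val_eqE /= Ee; lia.
have : Pr 0%N (t + z 0%N * r).
  have nz m : ~ Pr 0%N (z 0%N ^+ m).
    elim: m => [|m IHm]; first by rewrite expr0.
    by rewrite exprS => /PM[].
  suff [/nz|//] : Pr 0%N (z 0%N ^+ e0) \/ Pr 0%N (t + z 0%N * r) by [].
  by apply: PM; rewrite mulrDr -Er.
move=> /(sub 0%N _ isT) ht; have [II1 _ _] := Pp 1%N; have [_ _ IM1] := II1.
suff : Pr 1%N (t + z 0%N * r - r * z 0%N) by rewrite [r * _]mulrC addrK.
by apply: ideal_predB => //; exact: IM1.
Qed.

End Words.

Section LinearAlgebra.
Context (K : fieldType) (N : nat).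
Local Notation S := {mpoly K[N]}.

(** There are more polynomials than monomials available to them. *)
Lemma linear_relation (W : eqType) (ws : seq W) (ms : seq 'X_{1..N}) (v : W -> S) :
  uniq ws -> (forall w, w \in ws -> {subset msupp (v w) <= ms}) ->
  (size ms < size ws)%N ->
  exists2 c : W -> K, (exists2 w, w \in ws & c w != 0) &
    \sum_(w <- ws) (c w)%:MP * v w = 0.
Proof.
move=> uw sub lt; case: ws uw sub lt => // w0 ws'; set ws := w0 :: ws' => uw sub lt.
pose M : 'M[K]_(size ws, size ms) :=
  \matrix_(i, j) (v (nth w0 ws i))@_(nth 0%MM ms j).
have kM : kermx M != 0.
  rewrite kermx_eq0 /row_free neq_ltn; apply/orP; left.
  exact: leq_ltn_trans (rank_leq_col _) lt.
have /rowV0Pn[u uM u0] := kM.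
pose c w := if insub (index w ws) is Some i then u 0 i else 0.
have cE (i : 'I_(size ws)) : c (nth w0 ws i) = u 0 i.
  by rewrite /c index_uniq // insubT //= => h; congr (u 0 _); apply: val_inj.
exists c.
  have [i ui] : exists i, u 0 i != 0 by apply/rV0Pn.
  by exists (nth w0 ws i); rewrite ?mem_nth // cE.
have sumE : \sum_(w <- ws) (c w)%:MP * v w =
    \sum_(i < size ws) (u 0 i)%:MP * v (nth w0 ws i).
  by rewrite (big_nth w0) big_mkord; apply: eq_bigr => i _; rewrite cE.
rewrite sumE; apply/mpolyP => m; rewrite mcoeff0 raddf_sum /=.
under eq_bigr => i _ do rewrite mul_mpolyC mcoeffZ.
have [mm|mn] := boolP (m \in ms); last first.
  rewrite big1 // => i _; rewrite (memN_msupp_eq0 (m := m)) ?mulr0 //.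
  by apply: contra mn; apply: sub; rewrite mem_nth.
have im : (index m ms < size ms)%N by rewrite index_mem.
have /matrixP/(_ 0 (Ordinal im)) : u *m M = 0 by apply: sub_kermxP.
by rewrite !mxE => h; rewrite -[RHS]h; apply: eq_bigr => i _; rewrite !mxE /= nth_index.
Qed.

Lemma word_eval_kill F k (zs : seq S) (w : seq 'I_k) :
  word_eval [seq kill F z | z <- zs] w = kill F (word_eval zs w).
Proof.
elim: zs w => [|z zs IH] [|e w]; rewrite /word_eval /= ?big_nil ?rmorph1 //.
by rewrite !big_cons rmorphM /= rmorphXn -IH.
Qed.

Lemma deg_word_eval D k (zs : seq S) (w : seq 'I_k) (m : 'X_{1..N}) :
  (forall z, z \in zs -> forall m, m \in msupp z -> (mdeg m <= D)%N) ->
  m \in msupp (word_eval zs w) -> (mdeg m <= size zs * (k * D))%N.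
Proof.
have degM a b (p q : S) : (forall m, m \in msupp p -> (mdeg m <= a)%N) ->
    (forall m, m \in msupp q -> (mdeg m <= b)%N) ->
    forall m, m \in msupp (p * q) -> (mdeg m <= a + b)%N.
  move=> ha hb m' /msuppM_le /allpairsP[[m1 m2] /= [h1 h2 ->]].
  by rewrite mdegD leq_add ?ha ?hb.
have deg1 m' : m' \in msupp (1 : S) -> (mdeg m' <= 0)%N.
  by rewrite msupp1 inE => /eqP ->; rewrite mdeg0.
elim: zs w m => [|z zs IH] [|e w] m hz; rewrite /word_eval /= ?big_nil;
  try by move=> /deg1 h; apply: leq_trans h _.
rewrite big_cons mulSn /=; apply: (degM _ _); last first.
  by move=> m'; apply: IH => z' z'zs; apply: hz; rewrite inE z'zs orbT.
have degX i m' : m' \in msupp (z ^+ i) -> (mdeg m' <= i * D)%N.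
  elim: i m' => [|i IHi] m'; first by rewrite expr0 => /deg1.
  by rewrite exprS mulSn; apply: degM => //; apply: hz; rewrite mem_head.
move=> m' /degX h; apply: leq_trans h _.
by rewrite leq_mul2r ltnW ?orbT.
Qed.

(** Among the products of powers below k of n > d polynomials there are k ^ n,
    while modulo the variables in F they involve only the monomials in d
    variables with exponents below a multiple B of k, of which there are B ^ d;
    the former number is larger for large k. *)
Lemma algebraic_dependence (F : {set 'I_N}) d (zs : seq S) :
  (#|F| + d)%N = N -> (d < size zs)%N ->
  exists k (c : seq 'I_k -> K), (exists2 w, size w = size zs & c w != 0) /\
    var_ideal F (words_eval (@mpolyC N K) c zs).
Proof.
move=> Fd dz; set n := size zs in dz *.
pose ys := [seq kill F z | z <- zs].
pose D := \max_(y <- ys) msize y.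
pose E := (n * D).+1; pose k := (E ^ d).+1; pose B := (k * E)%N.
pose mk (f : {ffun {i | i \in ~: F} -> 'I_B}) : 'X_{1..N} :=
  [multinom (if insub i is Some j then nat_of_ord (f j) else 0%N) | i < N].
pose ms := [seq mk f | f <- enum {: {ffun {i | i \in ~: F} -> 'I_B}}].
have cF : #|{: {i | i \in ~: F}}| = d.
  by rewrite card_sig; have := cardsC F; rewrite card_ord -[in RHS]Fd => /addnI.
have sms : size ms = (B ^ d)%N by rewrite size_map -cardE card_ffun cF card_ord.
have lt : (size ms < size (words k n))%N.
  rewrite sms size_words; apply: (@leq_trans (k ^ d.+1)); last by rewrite leq_pexp2l.
  by rewrite expnMn expnSr ltn_pmul2l ?expn_gt0.
have memms (m : 'X_{1..N}) : (forall i, i \in F -> m i = 0%N) -> (mdeg m < B)%N -> m \in ms.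
  move=> mF mB; have mlt (j : {i | i \in ~: F}) : (m (val j) < B)%N.
    apply: leq_ltn_trans mB; rewrite mdegE (bigD1 (val j)) //=; exact: leq_addr.
  apply/mapP; exists [ffun j => Ordinal (mlt j)]; first by rewrite mem_enum.
  apply/mnmP => i; rewrite mnmE; case: insubP => [j _ ji|]; first by rewrite ffunE /= ji.
  by rewrite inE negbK => /mF.
have sub w : w \in words k n -> {subset msupp (word_eval ys w) <= ms}.
  move=> _ m mw; apply: memms.
    by move=> i iF; move: mw; rewrite word_eval_kill => /kill_support; apply.
  apply: leq_ltn_trans (deg_word_eval (D := D) _ mw) _.
    move=> y yy m' m'y; apply: leq_trans (ltnW (msize_mdeg_lt m'y)) _.
    exact: (bigop.leq_bigmax_seq y yy isT).
  by rewrite size_map -/n /B /E mulnS mulnCA -[X in (X < _)%N]add0n ltn_add2r.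
have [c [w ww cw] c0] := linear_relation (uniq_words k n) sub lt.
exists k, c; split; first by exists w => //; apply/eqP; rewrite -mem_words.
rewrite /var_ideal /words_eval rmorph_sum /= -[RHS]c0; apply: eq_bigr => w' _.
by rewrite rmorphM /= killC -word_eval_kill.
Qed.

End LinearAlgebra.

(** * Regular sequences and chains of primes *)

Section PrimeAvoiding.
Context (A : comNzRingType).
Implicit Types (I p : A -> Prop).

(** An ideal containing I that is maximal among those disjoint from the
    multiplicative set of all t x ^ n with t outside p is prime.  The ideal I
    itself is disjoint from this set because x is a nonzerodivisor modulo I. *)
Lemma prime_avoiding I p x : ideal_pred I -> prime_pred p ->
  (forall a, I a -> p a) -> (forall a, I (x * a) -> I a) ->
  exists2 q, prime_pred q & [/\ forall a, I a -> q a, forall a, q a -> p a & ~ q x].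
Proof.
move=> II [Ip p1 pM] sIp xreg; have [I0 ID IM] := II; have [p0 pD pMl] := Ip.
(* The empty set is admitted, so that the union over an empty chain is good. *)
pose good (J : classical_sets.set A) := [/\ forall a b, J a -> J b -> J (a + b),
  forall c a, J a -> J (c * a), forall a, J a -> forall b, I b -> J b &
  forall t n, ~ p t -> ~ J (t * x ^+ n)].
have goodI : good I.
  split=> // t n; elim: n => [|n IH] pt; first by rewrite mulr1 => /sIp.
  by rewrite exprS mulrCA => /xreg; apply: IH.
have [F goodF totF|J [goodJ maxJ]] := @classical_sets.Zorn_bigcup A good.
  split.
  - move=> a b [J FJ Ja] [J' FJ' Jb].
    have [sub|sub] := totF _ _ FJ FJ'.
      by exists J' => //; have [h _ _ _] := goodF _ FJ'; apply: h => //; apply: sub.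
    by exists J => //; have [h _ _ _] := goodF _ FJ; apply: h => //; apply: sub.
  - by move=> c a [J FJ Ja]; exists J => //; have [_ h _ _] := goodF _ FJ; exact: h.
  - by move=> a [J FJ Ja] b Ib; exists J => //; have [_ _ h _] := goodF _ FJ; exact: h Ja _ Ib.
  - by move=> t n pt [J FJ Ja]; have [_ _ _ h] := goodF _ FJ; exact: h pt Ja.
have [JD JM JI Jdis] := goodJ.
have [a0 Ja0] : exists a, J a.
  apply: contrapT => nJ; apply: (maxJ I) => //; split; first by move=> a Ja; case: nJ; exists a.
  by move=> /(_ 0 I0) J0; apply: nJ; exists 0.
have subIJ a : I a -> J a by exact: JI Ja0 a.
have JJ : ideal_pred J by split=> //; exact: subIJ.
have meet a : ~ J a -> exists t n, ~ p t /\ add_gen J a (t * x ^+ n).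
  move=> nJa; apply: contrapT => no; apply: (maxJ (add_gen J a)).
    split; first by move=> b; exact: add_gen_sub.
    by move=> /(_ a) h; apply/nJa/h; rewrite -[X in add_gen _ _ X]mul1r; exact: add_gen_mem.
  have [_ h1 h2] := add_gen_ideal a JJ.
  split=> // [b _ c Ic|t n pt h]; first exact/add_gen_sub/subIJ.
  by apply: no; exists t, n.
exists J; last split=> //.
- split=> //; first by move=> J1; apply: (Jdis 1 0%N p1); rewrite mulr1.
  move=> a b Jab; apply: contrapT => /not_orP[nJa nJb].
  have [t [n [pt [c hc]]]] := meet a nJa; have [u [m [pu [e he]]]] := meet b nJb.
  have ptu : ~ p (t * u) by move=> /pM[].
  apply: (Jdis (t * u) (n + m)%N ptu).
  have -> : t * u * x ^+ (n + m) = (u * x ^+ m) * (t * x ^+ n - c * a)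
     + (c * a) * (u * x ^+ m - e * b) + (c * e) * (a * b) by rewrite exprD; ring.
  by apply: (JD); [apply: (JD)|]; apply: JM.
- move=> a Ja; apply: contrapT => pa; apply: (Jdis a 0%N pa); by rewrite mulr1.
- by move=> Jx; apply: (Jdis 1 1%N p1); rewrite mul1r.
Qed.

(** Going down from p, each step is a prime that avoids the next element of the
    sequence but contains the previous ones. *)
Lemma regular_prime_chain I p xs : ideal_pred I -> prime_pred p ->
  (forall a, I a -> p a) -> (forall x, x \in xs -> p x) -> weakly_regular I xs ->
  exists Q : nat -> A -> Prop, [/\ forall i, prime_pred (Q i),
    Q (size xs) = p, forall a, I a -> Q 0%N a &
    forall i, (i < size xs)%N -> (forall a, Q i a -> Q i.+1 a) /\ exists x, Q i.+1 x /\ ~ Q i x].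
Proof.
move=> + pp; elim: xs I => [|x xs IH] I II sIp sxp /=; first by exists (fun=> p).
move=> [xreg xsreg].
have [||Q [Qp Qn QI Qs]] := IH _ (add_gen_ideal x II) _ _ xsreg.
- move=> a [b h]; have [[_ pD pM] _ _] := pp.
  have -> : a = (a - b * x) + b * x by rewrite subrK.
  by apply: pD; [exact: sIp | apply: pM; apply: sxp; rewrite mem_head].
- by move=> y yxs; apply: sxp; rewrite inE yxs orbT.
have xQ : Q 0%N x by apply: QI; rewrite -[x in X in _ X]mul1r; exact: add_gen_mem.
have [|q qp [Iq qQ qx]] := prime_avoiding II (Qp 0%N) _ xreg.
  by move=> a /add_gen_sub /QI.
exists (fun i => if i is j.+1 then Q j else q); split=> //; first by case.
by case=> [|i] lt; [split=> //; exists x | exact: Qs].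
Qed.

Lemma prime_chain_of_preds n (Q : nat -> A -> Prop) : (forall i, prime_pred (Q i)) ->
  (forall i, (i < n)%N -> (forall a, Q i a -> Q i.+1 a) /\ exists x, Q i.+1 x /\ ~ Q i x) ->
  prime_chain A n.
Proof.
move=> Qp Qs; have [p pP] := choice (fun i => prime_of_pred (Qp i)).
exists p => i lt; have [s1 [x [Qx nQx]]] := Qs i lt.
by split=> [a /pP /s1 /pP //|/(_ x)]; move=> /(_ (iffRL (pP _ _) Qx)) /pP.
Qed.

End PrimeAvoiding.

Section RegularSequences.
Context (A : comNzRingType).
Implicit Types (I J : A -> Prop) (xs : seq A).

Lemma foldl_add_gen_ideal I xs : ideal_pred I -> ideal_pred (foldl (@add_gen A) I xs).
Proof. by elim: xs I => //= x xs IH I II; apply/IH/add_gen_ideal. Qed.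

Lemma foldl_add_gen_sub I xs a : I a -> foldl (@add_gen A) I xs a.
Proof. by elim: xs I => //= x xs IH I Ia; apply/IH/add_gen_sub. Qed.

Lemma foldl_add_gen_mem I xs x : ideal_pred I -> x \in xs -> foldl (@add_gen A) I xs x.
Proof.
elim: xs I => //= y xs IH I II; rewrite inE => /orP[/eqP ->|xxs].
  by apply: foldl_add_gen_sub; rewrite -[X in add_gen _ _ X]mul1r; exact: add_gen_mem.
by apply: IH => //; exact: add_gen_ideal.
Qed.

Lemma foldl_add_gen_min I J xs a : ideal_pred J -> (forall a, I a -> J a) ->
  (forall x, x \in xs -> J x) -> foldl (@add_gen A) I xs a -> J a.
Proof.
move=> JJ; have [J0 JD JM] := JJ.
elim: xs I => /= [|x xs IH] I sI sx; first exact: sI.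
apply: IH => [b [c h]|y yxs]; last by apply: sx; rewrite inE yxs orbT.
have -> : b = (b - c * x) + c * x by rewrite subrK.
by apply: JD; [exact: sI | apply: JM; apply: sx; rewrite mem_head].
Qed.

Lemma ideal_gen_seq xs a :
  ideal_gen (fun x => x \in xs) a <-> foldl (@add_gen A) (fun a => a = 0) xs a.
Proof.
split; last first.
  apply: foldl_add_gen_min; [exact: ideal_gen_ideal| |by move=> x xxs; apply: ideal_gen_mem].
  by move=> b ->; have [] := ideal_gen_ideal (fun x => x \in xs).
apply: ideal_gen_min; first exact: (foldl_add_gen_ideal _ zero_ideal).
by move=> x; exact: (foldl_add_gen_mem zero_ideal).
Qed.

Lemma weakly_regularP I xs : weakly_regular I xs <->
  (forall i a, (i < size xs)%N -> foldl (@add_gen A) I (take i xs) (xs`_i * a) ->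
    foldl (@add_gen A) I (take i xs) a).
Proof.
elim: xs I => //= x xs IH I; split=> [[xr /IH h] [|i] a|h]; first by move=> _; exact: xr.
  exact: h.
by split; [move=> a; exact: (h 0%N a isT)| apply/IH => i a; exact: (h i.+1 a)].
Qed.

Lemma regular_sequenceP xs : regular_sequence xs <->
  weakly_regular (fun a : A => a = 0) xs /\ ~ ideal_gen (fun x => x \in xs) 1.
Proof.
split=> -[h n1]; split=> //.
  by apply/weakly_regularP => i a lt /ideal_gen_seq /(h i a lt) /ideal_gen_seq.
by move=> i a lt /ideal_gen_seq; move/weakly_regularP: h => /(_ i a lt) h /h /ideal_gen_seq.
Qed.

(** Depth never exceeds dimension, since regular sequences yield chains of
    primes; so a regular sequence as long as an upper bound of the dimension
    pins down both. *)
Lemma CM_local_of_bounds (m : prime_idealr A) n xs : local_ring m ->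
  weakly_regular (fun a : A => a = 0) xs -> (forall x, x \in xs -> x \in m) ->
  size xs = n -> (forall k, prime_chain A k -> (k <= n)%N) -> CM_local_ring A.
Proof.
move=> mloc xreg xm sxs dimA.
have mp := prime_idealr_prime_pred m; have [mi m1 _] := mp.
have chain ys : (forall y, y \in ys -> y \in m) -> weakly_regular (fun a : A => a = 0) ys ->
    prime_chain A (size ys).
  move=> ym yreg.
  have sub0 (a : A) : a = 0 -> a \in m by move=> ->; exact: idealr0.
  have [Q [Qp _ _ Qs]] := regular_prime_chain zero_ideal mp sub0 ym yreg.
  exact: prime_chain_of_preds Qp Qs.
exists m, n; split=> //; first by split=> //; rewrite -sxs; exact: chain.
split; last by move=> ys ym /regular_sequenceP[yreg _]; apply/dimA/chain.
exists xs; split=> //; apply/regular_sequenceP; split=> // h; apply: m1.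
exact: ideal_gen_min mi xm h.
Qed.

End RegularSequences.

(** * Localization *)

Section Transfer.
Context (S L : comNzRingType) (phi : {rmorphism S -> L}) (M : S -> Prop).
Hypothesis Mprime : prime_pred M.
Hypothesis phi_frac : forall l, exists t a, ~ M t /\ phi t * l = phi a.
Hypothesis phi_unit : forall t, ~ M t -> exists u, u * phi t = 1.

(** Clearing denominators: each element of L is, up to a unit, the image of an
    element of S. *)
Lemma weakly_regular_transfer (I : S -> Prop) (I' : L -> Prop) xs :
  ideal_pred I -> ideal_pred I' ->
  (forall a, I' (phi a) <-> exists2 u, ~ M u & I (u * a)) ->
  weakly_regular I xs -> weakly_regular I' (map phi xs).
Proof.
have [[M0 MD MM] M1 MP] := Mprime.
have MMn a b : ~ M a -> ~ M b -> ~ M (a * b) by move=> na nb /MP[].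
elim: xs I I' => //= x xs IH I I' II II' rel [xr xrs].
have [I0 ID IM] := II; have [I'0 I'D I'M] := II'.
have cancel t l : ~ M t -> I' (phi t * l) -> I' l.
  move=> /phi_unit[u ut] /(I'M u); by rewrite mulrA ut mul1r.
split.
  move=> l hl; have [t [a [nt Et]]] := phi_frac l; apply: (cancel t) => //.
  rewrite Et; apply/rel.
  have /rel[u nu hu] : I' (phi (x * a)) by rewrite rmorphM -Et mulrCA; exact: I'M.
  by exists u => //; apply: xr; rewrite mulrCA.
apply: (IH (add_gen I x)) => //; [exact: add_gen_ideal|exact: add_gen_ideal|].
move=> a; split=> [[l hl]|[u nu [b hb]]].
  have [t [b [nt Et]]] := phi_frac l.
  have /rel[u nu hu] : I' (phi (t * a - b * x)).
    rewrite rmorphB !rmorphM -Et -mulrA -mulrBr; exact: I'M.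
  exists (u * t); first exact: MMn.
  by exists (u * b); rewrite -!mulrA -mulrBr.
have /rel : exists2 v, ~ M v & I (v * (u * a - b * x)) by exists 1 => //; rewrite mul1r.
have [v vu] := phi_unit nu => /(I'M v); rewrite rmorphB !rmorphM mulrBr !mulrA vu mul1r => h.
by exists (v * phi b).
Qed.

End Transfer.

Section Localization.
Context (B : comNzRingType) (p : prime_idealr B).

Definition to_localization (b : B) : localization p := loc_frac b (denom1 p).

Lemma to_localization_is_zmod : zmod_morphism to_localization.
Proof.
move=> a b; rewrite /to_localization.
rewrite -[LHS]/(loc_frac _ _) -[RHS]/(loc_add _ (loc_opp _)) loc_oppE loc_addE.
by apply: loc_fracI; rewrite !SubK; ring.
Qed.

Lemma to_localization_is_monoid : monoid_morphism to_localization.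
Proof.
split=> [//|a b]; rewrite /to_localization -[RHS]/(loc_mul _ _) loc_mulE.
by apply: loc_fracI; rewrite !SubK; ring.
Qed.

HB.instance Definition _ :=
  GRing.isZmodMorphism.Build B (localization p) to_localization to_localization_is_zmod.
HB.instance Definition _ :=
  GRing.isMonoidMorphism.Build B (localization p) to_localization to_localization_is_monoid.

Lemma to_localization_frac b (s : denom p) :
  to_localization (val s) * loc_frac b s = to_localization b.
Proof.
rewrite -[LHS]/(loc_mul _ _) loc_mulE; apply: loc_fracI; rewrite !SubK; ring.
Qed.

Lemma to_localization_unit b : b \notin p -> exists u, u * to_localization b = 1.
Proof.
move=> bp; exists (loc_frac 1 (Sub b bp)).
rewrite -[LHS]/(loc_mul _ _) -[RHS]/(loc_frac _ _) loc_mulE; apply: loc_fracI.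
by rewrite !SubK; ring.
Qed.

Lemma to_localization_eq0 b : to_localization b = 0 <-> exists2 u, u \notin p & u * b = 0.
Proof.
rewrite -[X in _ = X]/(loc_frac _ _) loc_fracP; split=> -[u up h]; exists u => //.
  by move: h; rewrite !SubK mulr1 mul0r subr0.
by rewrite !SubK mulr1 mul0r subr0.
Qed.

Definition local_max (l : localization p) : Prop :=
  exists2 b, b \in p & exists s, l = loc_frac b s.

Lemma local_max_to b : local_max (to_localization b) <-> b \in p.
Proof.
split=> [[c cp [s /loc_fracP[u up]]]|bp]; last by exists b => //; exists (denom1 p).
rewrite !SubK mulr1 => h; have : u * (b * val s) \in p.
  have -> : u * (b * val s) = u * (b * val s - c) + u * c by ring.
  by rewrite h add0r idealMr.
by rewrite !prime_idealrM (negPf up) (negPf (valP s)) orbF.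
Qed.

Lemma local_max_unit l : ~ local_max l -> exists u, u * l = 1.
Proof.
have [b [s ->]] := loc_fracW l => nm.
have bp : b \notin p by apply/negP => bp; apply: nm; exists b => //; exists s.
exists (loc_frac (val s) (Sub b bp)).
rewrite -[LHS]/(loc_mul _ _) -[RHS]/(loc_frac _ _) loc_mulE; apply: loc_fracI.
by rewrite !SubK; ring.
Qed.

Lemma local_max_prime : prime_pred local_max.
Proof.
have mulS l (s : denom p) b : l = loc_frac b s -> local_max l <-> b \in p.
  move=> ->; split=> [[c cp [t /loc_fracP[u up h]]]|bp]; last by exists b => //; exists s.
  have : u * (b * val t) \in p.
    have -> : u * (b * val t) = u * (b * val t - c * val s) + (u * val s) * c by ring.
    by rewrite h add0r idealMr.
  by rewrite !prime_idealrM (negPf up) (negPf (valP t)) orbF.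
split; last first.
- move=> x y; have [a [s ->]] := loc_fracW x; have [b [t ->]] := loc_fracW y.
  rewrite (mulS _ _ _ (loc_mulE a b s t)) prime_idealrM => /orP[h|h]; [left|right].
    by apply/mulS.
  by apply/mulS.
- by rewrite (mulS _ _ _ (erefl : 1 = loc_frac 1 (denom1 p))) idealr1.
split.
- by rewrite (mulS _ _ _ (erefl : 0 = loc_frac 0 (denom1 p))) idealr0.
- move=> x y; have [a [s ->]] := loc_fracW x; have [b [t ->]] := loc_fracW y.
  move=> /(mulS _ _ _ erefl) ap /(mulS _ _ _ erefl) bp.
  apply/(mulS _ _ _ (loc_addE a b s t)).
  by rewrite rpredD // mulrC idealMr.
move=> x y; have [a [s ->]] := loc_fracW x; have [b [t ->]] := loc_fracW y.
move=> /(mulS _ _ _ erefl) bp; apply/(mulS _ _ _ (loc_mulE a b s t)).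
exact: idealMr.
Qed.

(** Everything outside the extension of p is a unit, so all proper ideals are
    contained in it. *)
Lemma localization_local : exists2 m : prime_idealr (localization p), local_ring m &
  forall l, l \in m <-> local_max l.
Proof.
have [m mP] := prime_of_pred local_max_prime; exists m => //.
have sub (J : idealr (localization p)) : {subset J <= m}.
  move=> l lJ; apply: contrapT => lm.
  have [u ul] : exists u, u * l = 1 by apply: local_max_unit => /mP.
  by have := idealMr u lJ; rewrite ul idealr1.
split; first by move=> J _; exact: sub.
move=> m' mx' l; apply/idP/idP; first exact: sub.
by apply: mx'; exact: sub.
Qed.

End Localization.

(** * Cohen-Macaulayness of intersections with the exchange property *)

Section Preimage.
Context (A B : comNzRingType) (phi : {rmorphism A -> B}).

Lemma prime_pred_preim (p : prime_idealr B) : prime_pred (fun a => phi a \in p).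
Proof.
split; last by move=> a b; rewrite rmorphM prime_idealrM => /orP.
  split; first by rewrite rmorph0 idealr0.
    by move=> a b ha hb; rewrite rmorphD rpredD.
  by move=> c a ha; rewrite rmorphM idealMr.
by rewrite rmorph1 idealr1.
Qed.

End Preimage.

Section CohenMacaulay.
Context (K : fieldType) (N : nat).
Local Notation S := {mpoly K[N]}.
Context (FF : {set {set 'I_N}}) (ord : {perm 'I_N}) (d : nat).
Hypothesis ex : exchange_family ord FF.
Hypothesis FF_card : forall F, F \in FF -> (#|F| + d)%N = N.
Hypothesis FF_neq0 : exists F, F \in FF.
Local Notation I := (@facet_ideal K N FF).
Hypothesis FF_prime : forall p : S -> Prop, prime_pred p -> (forall f, I f -> p f) ->
  exists2 F, F \in FF & forall f, var_ideal F f -> p f.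

(** A chain with d + 2 primes would give d + 1 polynomials that are algebraically
    independent modulo the smallest prime, which contains one of the variable
    ideals. *)
Lemma facet_dimension (L : comNzRingType) (phi : {rmorphism S -> L}) n :
  (forall f, I f -> phi f = 0) ->
  (forall l, exists t a, (exists u, u * phi t = 1) /\ phi t * l = phi a) ->
  prime_chain L n -> (n <= d)%N.
Proof.
move=> phiI frac [p ps]; rewrite leqNgt; apply/negP => dn.
pose Pr i := fun f => phi f \in p i.
have Pp i : prime_pred (Pr i) by exact: prime_pred_preim.
have zex i : exists z, (i < d.+1)%N -> Pr i.+1 z /\ ~ Pr i z.
  have [lt|] := boolP (i < d.+1)%N; last by exists 0.
  have [_ ns] := ps i (leq_trans lt dn).
  have [l [l1 l0]] : exists l, l \in p i.+1 /\ l \notin p i.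
    apply: contrapT => no; apply: ns => l l1; apply: contrapT => /negP l0.
    by apply: no; exists l.
  have [t [a [[u ut] Et]]] := frac l; exists a => _; rewrite /Pr -Et; split.
    exact: idealMr.
  by move/(idealMr u); rewrite mulrA ut mul1r (negPf l0).
have [z zP] := choice zex.
have [F FFF sF] : exists2 F, F \in FF & forall f, var_ideal F f -> Pr 0%N f.
  by apply: FF_prime => // f /phiI f0; rewrite /Pr f0 idealr0.
have [||k [c [[w sw cw] h]]] := @algebraic_dependence K N F d (mkseq z d.+1).
- exact: FF_card.
- by rewrite size_mkseq.
move/eqP: cw; apply.
apply: (@chain_independent _ _ (@mpolyC N K) k d.+1 Pr z c) => //.
- move=> i a lt; exact: (ps i (leq_trans lt dn)).1.
- exact: sF.
- by rewrite sw size_mkseq.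
Qed.

Lemma elem_syms_mem (A : comNzRingType) (T : finType) (y : T -> A) (p : A -> Prop) m x :
  ideal_pred p -> (forall j, p (y j)) -> x \in elem_syms y m -> p x.
Proof.
move=> [p0 pD pM] py; elim: m => //= m IH; rewrite inE => /orP[/eqP ->|/IH //].
rewrite /elem_sym; apply: (big_ind p) => // B cB.
have [j jB] : exists j, j \in B by apply/card_gt0P; rewrite (eqP cB).
by rewrite (bigD1 j) //= mulrC; apply: pM.
Qed.

Lemma size_elem_syms (A : comNzRingType) (T : finType) (y : T -> A) m :
  size (elem_syms y m) = m.
Proof. by elim: m => //= m ->. Qed.

(** At each maximal ideal the elementary symmetric polynomials of the parameters
    attached to this maximal ideal form a regular sequence of length d. *)
Lemma facet_ideal_CM : CM_ideal I.
Proof.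
have [|J JI] := idealr_of_pred (@facet_ideal_ideal K N FF).
  have [F FFF] := FF_neq0; move=> /(_ F FFF).
  by have [_ n1 _] := var_ideal_prime K F.
exists J => // m mx.
pose pi_ := \pi_{ideal_quot J} : {rmorphism S -> {ideal_quot J}}.
have pi_surj b : exists f, b = pi_ f by exists (repr b); rewrite /= reprK.
have pi0 f : pi_ f = 0 <-> I f.
  rewrite -JI -(rmorph0 pi_); split=> [/eqP|h].
    by rewrite piE /= Quotient.equivE subr0.
  by apply/eqP; rewrite piE /= Quotient.equivE subr0.
have [g gm gM] : exists2 g : 'I_N -> {poly K}, forall j, g j \is monic &
    forall j, pi_ (upoly j (g j)) \in m.
  have gex j : exists g, g \is monic /\ pi_ (upoly j g) \in m.
    by have [g gm gM] := nullstellensatz pi_surj mx j; exists g.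
  have [g gP] := choice gex.
  by exists g => j; case: (gP j).
pose phi := (@to_localization _ m \o pi_ : {rmorphism S -> localization m}).
pose M f := pi_ f \in m.
have Mp : prime_pred M by exact: prime_pred_preim.
have frac l : exists t a, ~ M t /\ phi t * l = phi a.
  have [b [s ->]] := loc_fracW l; have [a Ea] := pi_surj b; have [t Et] := pi_surj (val s).
  exists t, a; split; first by rewrite /M -Et; apply/negP; exact: (valP s).
  by rewrite /= -Ea -Et to_localization_frac.
have unit t : ~ M t -> exists u, u * phi t = 1.
  by move=> /negP Mt; apply: to_localization_unit.
have zero f : phi f = 0 <-> exists2 u, ~ M u & I (u * f).
  rewrite to_localization_eq0; split=> [[v vm h]|[u Mu h]].
    have [u Eu] := pi_surj v; exists u; first by rewrite /M -Eu; apply/negP.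
    by apply/pi0; rewrite rmorphM -Eu.
  by exists (pi_ u); [apply/negP | rewrite -rmorphM; apply/pi0].
pose th := elem_syms (param_var g) d.
have [m' mloc m'P] := localization_local m.
apply: (@CM_local_of_bounds _ m' d (map phi th)) => //.
- apply: (weakly_regular_transfer Mp frac unit (@facet_ideal_ideal K N FF) zero_ideal zero).
  apply: (facet_ideal_regular ex) => F FFF; apply: var_ideal_params_regular => //.
  exact: FF_card.
- move=> l /mapP[f fth ->]; apply/m'P/local_max_to.
  have [Mi _ _] := Mp; apply: (elem_syms_mem Mi _ fth) => j.
  by have [_ _ MM] := Mi; rewrite param_varE; apply: MM; exact: gM.
- by rewrite size_map size_elem_syms.
move=> k; apply: (facet_dimension (phi := phi)).
  by move=> f If; apply/zero; exists 1; [case: Mp | rewrite mul1r].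
by move=> l; have [t [a [nt Et]]] := frac l; exists t, a; split=> //; exact: unit.
Qed.

End CohenMacaulay.

(** * The multichain ideal and its Alexander dual *)

Section SquarefreeMonomials.
Context (K : fieldType) (N : nat).
Local Notation S := {mpoly K[N]}.
Implicit Types (F G : {set 'I_N}) (m u : 'X_{1..N}).

Definition set_mnm F : 'X_{1..N} := [multinom (i \in F : nat) | i < N].

Lemma set_mnm_prod F : \prod_(i in F) 'X_i = 'X_[set_mnm F] :> S.
Proof.
rewrite [RHS]mpolyXE_id [LHS]big_mkcond; apply: eq_bigr => i _.
by rewrite mnmE; case: (i \in F).
Qed.

Lemma set_mnm_le F m : (set_mnm F <= m)%MM = [forall i in F, (0 < m i)%N].
Proof.
apply/mnm_lepP/forall_inP => h i; first by move=> iF; have := h i; rewrite mnmE iF.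
by rewrite mnmE; have := h i; case: (i \in F) => // ->.
Qed.

Lemma mdeg_set_mnm F : mdeg (set_mnm F) = #|F|.
Proof.
rewrite mdegE -sum1_card [RHS]big_mkcond; apply: eq_bigr => i _.
by rewrite mnmE; case: (i \in F).
Qed.

Lemma monomial_dvd (I : S -> Prop) u m : ideal_pred I -> (u <= m)%MM -> I 'X_[u] -> I 'X_[m].
Proof. by move=> [_ _ IM] um Iu; rewrite -(submK um) mpolyXD; exact: IM. Qed.

Lemma monomial_ideal_gen (M : 'X_{1..N} -> Prop) m :
  ideal_gen (fun g : S => exists2 u, M u & g = 'X_[u]) 'X_[m] ->
  exists2 u, M u & (u <= m)%MM.
Proof.
move=> h.
suff /(_ m) : forall m', m' \in msupp ('X_[m] : S) -> exists2 u, M u & (u <= m')%MM.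
  by apply; rewrite msuppX inE.
move: h; set f := 'X_[m] : S; move: f => f.
apply: (ideal_gen_min (J := fun f : S => forall m', m' \in msupp f -> exists2 u, M u & (u <= m')%MM)).
  split=> [m'|a b ha hb m'|c a ha m']; first by rewrite msupp0.
    by move=> /msuppD_le; rewrite mem_cat => /orP[/ha|/hb].
  move=> /msuppM_le/allpairsP[[m1 m2] /= [_ /ha[u Mu um] ->]]; exists u => //.
  by apply: lepm_trans um _; rewrite lem_addl.
move=> g [u Mu ->] m'; rewrite msuppX inE => /eqP ->; exists u => //; exact: lepm_refl.
Qed.

End SquarefreeMonomials.

Section Covers.
Context (K : fieldType) (disp : Order.disp_t) (P : finPOrderType disp) (r s : nat).
Context (hs : (1 <= s)%N) (hsr : (s <= r)%N).
Local Notation T := ('I_r * P)%type.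
Local Notation N := (nvars P r).
Local Notation S := {mpoly K[N]}.
Local Notation I := (multichain_ideal K P r s).

Definition var_complement (F : {set 'I_N}) : {set T} := [set x | enum_rank x \notin F].

Definition facet_covers : {set {set 'I_N}} := [set F | facet s (var_complement F)].
Local Notation FF := facet_covers.

Definition hits_multichains (G : {set 'I_N}) : Prop := forall (c : 'I_r -> P) (A : {set 'I_r}),
  multichain c -> #|A| = s -> exists2 i, i \in A & enum_rank (i, c i) \in G.

Lemma facet_cover_hits F : F \in FF -> hits_multichains F.
Proof.
rewrite inE => /(facet_independent hs hsr) ind c A mc cA.
by have [i iA] := ind c A mc cA; rewrite inE negbK; exists i.
Qed.

(** The complement of a set that meets all generators is a face, and is contained
    in a facet. *)
Lemma hits_facet_cover G : hits_multichains G -> exists2 F, F \in FF & F \subset G.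
Proof.
move=> hit; have ind : independent s (var_complement G).
  by move=> c A mc cA; have [i iA iG] := hit c A mc cA; exists i; rewrite // inE negbK.
have [sub fac] := independent_sub_facet hs hsr ind.
exists [set i | enum_val i \notin facet_extension s (var_complement G)].
  rewrite inE; set W := facet_extension s _ in fac *.
  suff -> : var_complement [set i | enum_val i \notin W] = W by [].
  by apply/setP => x; rewrite !inE enum_rankK negbK.
apply/subsetP => i; rewrite inE; apply: contraR => iG.
by apply: (subsetP sub); rewrite inE enum_valK.
Qed.

Lemma facet_covers_card F : F \in FF -> (#|F| + s.-1 * #|P|)%N = N.
Proof.
rewrite inE => /facet_card <-; have <- : #|~: F| = #|var_complement F|.
  rewrite -(card_imset (mem (var_complement F)) enum_rank_inj); apply: eq_card => i.
  rewrite !inE; apply/idP/imsetP => [iF|[x xF ->]]; last by move: xF; rewrite !inE.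
  by exists (enum_val i); rewrite ?enum_valK // !inE enum_valK.
by rewrite cardsC card_ord.
Qed.

Lemma facet_covers_min F G : F \in FF -> G \in FF -> F \subset G -> F = G.
Proof.
move=> FFF GFF sFG; apply/eqP; rewrite eqEcard sFG /=.
by have := etrans (facet_covers_card FFF) (esym (facet_covers_card GFF)); move=> /addIn ->.
Qed.

Lemma facet_covers_neq0 : exists F, F \in FF.
Proof.
have [|F FFF _] := @hits_facet_cover setT; last by exists F.
move=> c A mc cA; have : (0 < #|A|)%N by rewrite cA.
by case/card_gt0P => i iA; exists i; rewrite ?inE.
Qed.

Lemma u_monE (c : 'I_r -> P) A :
  u_mon K c A = 'X_[set_mnm [set enum_rank (i, c i) | i in A]].
Proof.
rewrite -set_mnm_prod big_imset //= => i j _ _ /enum_rank_inj; by case.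
Qed.

Lemma multichain_ideal_ideal : ideal_pred I.
Proof. exact: ideal_gen_ideal. Qed.

Lemma u_mon_prime (p : S -> Prop) c A : prime_pred p -> p (u_mon K c A) ->
  exists2 i, i \in A & p ('X_(enum_rank (i, c i))).
Proof.
move=> [_ p1 pM] pu; apply: contrapT => no; move: pu; rewrite /u_mon.
by elim/big_ind: _ => // [a b ha hb /pM[]|i iA pi] //; apply: no; exists i.
Qed.

(** Both sides are monomial ideals; a monomial whose support meets all minimal
    covers has a support that is not a face, so some generator divides it. *)
Lemma multichain_idealE : I = @facet_ideal K N FF.
Proof.
apply: pred_ext => f; split.
  apply: ideal_gen_min; first exact: facet_ideal_ideal.
  move=> g [c [A [mc cA ->]]] F /facet_cover_hits/(_ c A mc cA)[i iA iF].
  have [_ _ M] := var_ideal_ideal K F; rewrite /u_mon (bigD1 i) //= mulrC; apply: M.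
  exact/var_ideal_var.
move=> h; have [I0 ID IM] := multichain_ideal_ideal.
rewrite (mpolyE f) big_seq; apply: (big_ind I) => // m mf.
rewrite -mul_mpolyC; apply: IM.
have : ~ hits_multichains [set i | m i == 0%N].
  move=> /hits_facet_cover[F /h /var_ideal_support /(_ m mf)[i iF mi] /subsetP/(_ i iF)].
  by rewrite inE eqn0Ngt mi.
move=> nh; apply: contrapT => nI; apply: nh => c A mc cA; apply: contrapT => no; apply: nI.
apply: (monomial_dvd multichain_ideal_ideal (u := set_mnm [set enum_rank (i, c i) | i in A])).
  rewrite set_mnm_le; apply/forall_inP => j /imsetP[i iA ->].
  rewrite lt0n; apply/negP => m0; apply: no; exists i => //; by rewrite inE.
by rewrite -u_monE; apply: ideal_gen_mem; exists c, A.
Qed.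

Lemma prime_over_multichain_ideal (p : S -> Prop) : prime_pred p ->
  (forall f, I f -> p f) ->
  exists2 F, F \in FF & forall f, var_ideal F f -> p f.
Proof.
move=> pp Ip.
have [|F FFF /subsetP sF] := @hits_facet_cover [set i | `[< p 'X_i >]].
  move=> c A mc cA; have [|i iA pi] := @u_mon_prime p c A pp.
    by apply: Ip; apply: ideal_gen_mem; exists c, A.
  by exists i => //; rewrite inE; apply/asboolP.
exists F => // f f0; have <- : f - kill F f = f by rewrite f0 subr0.
have [II _ _] := pp; apply: ideal_sub_kill => // i /sF.
by rewrite inE => /asboolP.
Qed.

(** The complements of facets are covers of one and the same size, so none of
    them contains another, and each prime over the ideal contains the ideal of
    one of them. *)
Lemma minimal_prime_facet (p : prime_idealr S) (F : {set 'I_N}) :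
  (forall f, f \in p <-> ideal_gen (fun h : S => exists2 i, i \in F & h = 'X_i) f) ->
  minimal_prime I p <-> F \in FF.
Proof.
move=> pF; have pv f : f \in p <-> var_ideal F f by rewrite pF -var_ideal_gen.
split=> [[Ip pmin]|FFF].
  have [G GFF Gp] := prime_over_multichain_ideal (prime_idealr_prime_pred p) Ip.
  have [q qG] := prime_of_pred (var_ideal_prime K G).
  have qp : {subset p <= q}.
    apply: pmin => [f If|f /qG /Gp //]; apply/qG.
    by move: If; rewrite multichain_idealE; apply.
  suff -> : F = G by [].
  apply/eqP; rewrite eqEsubset; apply/andP; split; apply/subsetP => i iF.
    by apply/(var_ideal_var K)/qG/qp/pv/var_ideal_var.
  by apply/(var_ideal_var K)/pv/Gp/var_ideal_var.
split=> [f|q Iq qp f /pv pf].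
  by rewrite multichain_idealE => h; apply/pv/h.
have [G GFF Gq] := prime_over_multichain_ideal (prime_idealr_prime_pred q) Iq.
suff E : G = F by apply: Gq; rewrite E.
apply: facet_covers_min => //; apply/subsetP => i iG.
by apply/(var_ideal_var K)/pv/qp/Gq/var_ideal_var.
Qed.

Lemma dual_multichain_idealE : dual_multichain_ideal K P r s =
  ideal_gen (fun g : S => exists2 u, (exists2 F, F \in FF & u = set_mnm F) & g = 'X_[u]).
Proof.
rewrite /dual_multichain_ideal /alexander_dual; congr ideal_gen; apply: pred_ext => g.
split=> [[F [p [pmin pF ->]]]|[u [F FFF ->] ->]].
  exists (set_mnm F); last by rewrite set_mnm_prod.
  by exists F => //; apply/(minimal_prime_facet pF).
have [p pF] := prime_of_pred (var_ideal_prime K F).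
have pF' f : f \in p <-> ideal_gen (fun h : S => exists2 i, i \in F & h = 'X_i) f.
  by rewrite pF var_ideal_gen.
exists F, p; split=> //; last by rewrite set_mnm_prod.
exact/(minimal_prime_facet pF').
Qed.

Definition index_key (i : 'I_N) : nat := var_key (enum_val i).

Lemma key_order : exists ord : {perm 'I_N},
  forall k t : 'I_N, (index_key (ord k) < index_key (ord t))%N -> (k < t)%N.
Proof.
pose sq := sort (relpre index_key leq) (enum 'I_N).
have szq : size sq = N by rewrite size_sort size_enum_ord.
have inj : injective (fun k : 'I_N => nth k sq k).
  move=> k t; rewrite (set_nth_default t) ?szq // => /eqP.
  by rewrite nth_uniq ?szq // ?sort_uniq ?enum_uniq // => /eqP/val_inj.
exists (perm inj) => k t; rewrite !permE; apply: contraTltn => tk; rewrite -leqNgt.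
rewrite [nth t sq t](set_nth_default k) ?szq //.
have so : sorted (relpre index_key leq) sq by apply: sort_sorted => a b /=; exact: leq_total.
apply: (sorted_leq_nth _ _ k so) => //; rewrite ?inE ?szq //.
- by move=> a b c; exact: leq_trans.
- by move=> a; exact: leqnn.
Qed.

Lemma facet_covers_exchange (ord : {perm 'I_N}) :
  (forall k t : 'I_N, (index_key (ord k) < index_key (ord t))%N -> (k < t)%N) ->
  exchange_family ord FF.
Proof.
move=> ordP U V; rewrite !inE => Uf Vf t agree tU tV.
have [|||l [kl lV fac]] := facet_exchange hs hsr (t := enum_val (ord t)) Uf Vf.
- move=> x kx; rewrite !inE; congr (~~ _); rewrite -(permKV ord (enum_rank x)).
  by apply: agree; apply: ordP; rewrite permKV /index_key enum_rankK.
- by rewrite inE enum_valK.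
- by rewrite inE enum_valK tU.
move: lV; rewrite inE negbK => lV.
exists (ord^-1%g (enum_rank l)); rewrite permKV; split=> //.
  by apply: ordP; rewrite permKV /index_key enum_rankK.
rewrite inE; suff -> : var_complement (ord t |: V :\ enum_rank l) =
   l |: var_complement V :\ enum_val (ord t) by [].
apply/setP => x; rewrite !inE (inj_eq enum_rank_inj).
rewrite -[x == enum_val _](inj_eq enum_rank_inj) enum_valK.
have [->|_] /= := eqVneq x l; last by rewrite negb_or.
by rewrite orbF; apply: contraNneq tV => <-.
Qed.

Lemma dual_weakly_polymatroidal : exists ord : {perm 'I_N},
  weakly_polymatroidal ord (dual_multichain_ideal K P r s).
Proof.
have [ord ordP] := key_order; exists ord.
have ex := facet_covers_exchange ordP.
rewrite dual_multichain_idealE.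
set H := ideal_gen _.
have Hmem F : F \in FF -> H 'X_[set_mnm F].
  by move=> FFF; apply: ideal_gen_mem; exists (set_mnm F) => //; exists F.
have gens u : min_gens H u -> exists2 F, F \in FF & u = set_mnm F.
  move=> [Hu umin]; have [v [F FFF ->] Fu] := monomial_ideal_gen Hu.
  by exists F => //; apply/esym/umin => //; apply: Hmem.
split.
- by exists (fun u => exists2 F, F \in FF & u = set_mnm F).
- exists (N - s.-1 * #|P|)%N => u /gens[F FFF ->].
  by have := facet_covers_card FFF; rewrite mdeg_set_mnm; lia.
move=> u v /gens[U UF ->] /gens[V VF ->] t agree.
rewrite !mnmE => lt.
have tU : ord t \in U by move: lt; case: (ord t \in U); case: (_ \in V).
have tV : ord t \notin V by move: lt; case: (ord t \in V); case: (_ \in U).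
have [|l [tl lV WF]] := ex U V UF VF t _ tU tV.
  by move=> k /agree; rewrite !mnmE; case: (_ \in U); case: (_ \in V).
exists l; split=> //; first by rewrite mnmE lV.
suff -> : 'X_(ord t) * 'X_[set_mnm V - U_(ord l)] = 'X_[set_mnm (ord t |: V :\ ord l)] :> S.
  exact: Hmem.
rewrite -mpolyXD; congr 'X_[_]; apply/mnmP => i; rewrite !(mnmE, inE).
rewrite ![i == _]eq_sym; have [<-|ti] := eqVneq (ord t) i.
  by rewrite (negPf tV) sub0n.
by rewrite add0n; have [<-|li] := eqVneq (ord l) i; rewrite ?lV // subn0.
Qed.

End Covers.

Theorem theorem2p4 (K : fieldType) (disp : Order.disp_t)
    (P : finPOrderType disp) (r s : nat) (hs : (1 <= s)%N) (hsr : (s <= r)%N) :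
  (exists ord : {perm 'I_(nvars P r)},
     weakly_polymatroidal ord (dual_multichain_ideal K P r s)) /\
  CM_ideal (multichain_ideal K P r s).
Proof.
split; first exact: dual_weakly_polymatroidal.
have [ord ordP] := key_order P r.
rewrite multichain_idealE //.
apply: (@facet_ideal_CM _ _ _ ord (s.-1 * #|P|)%N).
- exact: facet_covers_exchange ordP.
- exact: facet_covers_card.
- exact: facet_covers_neq0.
by move=> p pp; rewrite -multichain_idealE //; apply: prime_over_multichain_ideal.
Qed.
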